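(* Consider the one-dimensional DLA process $R(\cdot)$ with $R(0)=0$, and assume that $\{N(i,0)\}_{i\ge 1}$ is a stationary ergodic sequence with $E\{N(i,0)\}=\mu$. If $0<\mu<1$, then $$\lim_{t\to\infty}\frac{R(t)}{(\log t)^2\sqrt t}=0\quad\text{a.s.}$$ Moreover, $R(t)/\sqrt t$, $t\ge 1$, is a tight family, that is, $$P\{R(t)\ge x\sqrt t\}\to 0\quad\text{as }x\to\infty,\text{ uniformly in }t\ge 1.$$ If, in addition, the $N(i,0)$, $i\ge 1$, are i.i.d. Poisson random variables with mean $\mu$ (still with $0<\mu<1$), then $$\limsup_{t\to\infty}\frac{R(t)}{\sqrt t}<\infty\quad\text{a.s.}$$
   Context: One-dimensional DLA process. Fix a jump rate $D>0$. At time $0$ there are $N(i,0)\in\{0,1,2,\dots\}$ particles at each site $i\ge 1$ of $\mathbb{Z}$ (and no other particles), all colored white. All particles perform continuous-time symmetric simple random walks on $\mathbb{Z}$ with jump rate $D$, independent of each other and of the $N(i,0)$. The path of a particle is not influenced by its color. Put $\tau_0=0$ and $R(0)=0$. Inductively, given $\tau_k$ with $R(\tau_k)=k$ and no white particles in $[0,k]$ at time $\tau_k$, let $$\tau_{k+1}=\inf\{t>\tau_k:\text{ some white particle jumps to position }k\text{ at time }t\}$$ (such a jump is necessarily from $k+1$ to $k$). At time $\tau_{k+1}$, all white particles that were at $k+1$ at time $\tau_{k+1}-$ (including the one that jumped) change color to black and stay black forever, and $R$ increases to $k+1$. Black particles have no influence on $R$ or on other particles. Thus $R(t)=k$ for $\tau_k\le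 t<\tau_{k+1}$. *)

(* Defs.v *)
From HB Require Import structures.
From mathcomp Require Import all_boot all_order all_algebra.
From mathcomp Require Import all_classical all_reals all_analysis.
Import Order.TTheory GRing.Theory Num.Theory.
Import numFieldNormedType.Exports.

Set Implicit Arguments.
Unset Strict Implicit.
Unset Printing Implicit Defensive.

Local Open Scope classical_set_scope.
Local Open Scope ring_scope.

Definition mutually_independent {d : measure_display} {Omega : measurableType d}
    {R : realType} (P : probability Omega R) {I : eqType}
    (F : I -> set (set Omega)) : Prop :=
  forall (s : seq I) (A : I -> set Omega), uniq s ->
    (forall i, i \in s -> F i (A i)) ->
    P (\bigcap_(i in [set` s]) A i) = (\prod_(i <- s) P (A i))%E.

(** The product sigma-algebra on the space [nat -> nat] of sequences. *)
Definition seq_measurable : set (set (nat -> nat)) :=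
  <<s [set C | exists i k : nat, C = [set x : nat -> nat | x i = k]] >>.

Definition seq_shift (x : nat -> nat) : nat -> nat := fun i => x i.+1.

Section initial_condition.
Context {d : measure_display} {Omega : measurableType d} {R : realType}.
Context (P : probability Omega R) (N : nat -> {mfun Omega >-> nat}).

Definition seq_of (w : Omega) : nat -> nat := fun i => N i w.

Definition stationary : Prop :=
  forall A, seq_measurable A ->
    P [set w | A (seq_shift (seq_of w))] = P [set w | A (seq_of w)].

Definition ergodic : Prop :=
  forall A, seq_measurable A -> seq_shift @^-1` A = A ->
    P [set w | A (seq_of w)] = 0%E \/ P [set w | A (seq_of w)] = 1%E.

Definition iid_poisson (mu : R) : Prop :=
  mutually_independent P (fun i => g_sigma_algebra_preimage (N i)) /\
  forall i k, P [set w | N i w = k] = (poisson_pmf mu k)%:E.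

End initial_condition.

(** Site [i >= 1] of the half-line is encoded by [i.-1 : nat]. The particle
    [(i, j)] is the [j]-th one (from [j = 0]) among those starting from site
    [i.+1]. A walk is attached to every pair [(i, j)]; only the pairs with
    [j < N i] are particles of the system. *)
Notation particle := (nat * nat)%type.

(** A continuous-time nearest-neighbour walk is given by its starting site [x],
    its holding times [h] and its directions [b] ([true] is a step [+1],
    [false] a step [-1]): its [n]-th jump ([n >= 1]) occurs at
    [jump_time h n], and its position is [walk_pos x b n] on
    [[jump_time h n, jump_time h n.+1[]. *)
Definition jump_time {R : realType} (h : nat -> R) (n : nat) : R :=
  \sum_(m < n) h m.

Definition walk_pos (x : int) (b : nat -> bool) (n : nat) : int :=
  x + \sum_(m < n) (if b m then 1 else -1).

Definition jumps_to {R : realType} (x : int) (h : nat -> R) (b : nat -> bool)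
    (y : int) (t : R) : Prop :=
  exists n : nat, t = jump_time h n.+1 /\ walk_pos x b n.+1 = y.

(** The left limit of the path at time [t] is [y]. *)
Definition at_before {R : realType} (x : int) (h : nat -> R) (b : nat -> bool)
    (y : int) (t : R) : Prop :=
  exists n : nat, jump_time h n < t <= jump_time h n.+1 /\ walk_pos x b n = y.

Section dla_dynamics.
Context {R : realType}.
(** A realisation: [eta i] particles at site [i.+1], and the walks. *)
Context (eta : nat -> nat) (h : particle -> nat -> R)
        (b : particle -> nat -> bool).

Definition start (p : particle) : int := p.1.+1%:Z.

(** The pair of [tau_k] and of the set of the particles that are white at time
    [tau_k] (after the change of color at that time). [tau_k = +oo] when the
    infimum is taken over the empty set; no change of color then happens. *)
Fixpoint dla_state (k : nat) : \bar R * set particle :=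
  match k with
  | 0 => (0%E, [set p | (p.2 < eta p.1)%N])
  | k'.+1 =>
    let: (tau, white) := dla_state k' in
    let tau' := ereal_inf [set t%:E | t in
      [set t : R | (tau < t%:E)%E /\
         exists2 p, white p & jumps_to (start p) (h p) (b p) k'%:Z t]] in
    (tau', white `\` [set p | exists2 t : R, tau' = t%:E &
                        at_before (start p) (h p) (b p) k'.+1%:Z t])
  end.

Definition dla_tau (k : nat) : \bar R := (dla_state k).1.

(** [k] on [[tau_k, tau_(k+1)[]. The value [+oo] accounts for a possible
    accumulation of the [tau_k], which is not excluded a priori. *)
Definition dla_front (t : R) : \bar R :=
  ereal_sup [set k%:R%:E | k in [set k : nat | (dla_tau k <= t%:E)%E]].

End dla_dynamics.

Section dla_process.
Context {d : measure_display} {Omega : measurableType d} {R : realType}.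
Context (P : probability Omega R) (D : R).
Context (N : nat -> {mfun Omega >-> nat})
        (hold : particle -> nat -> {RV P >-> R})
        (dir : particle -> nat -> {RV P >-> bool}).

(** [None]: the whole initial configuration; [inl] and [inr]: a holding time
    and a direction of a walk. *)
Definition dla_sigma (i : option ((particle * nat) + (particle * nat))) :
    set (set Omega) :=
  match i with
  | None => preimage_set_system setT (seq_of N) seq_measurable
  | Some (inl (p, n)) => g_sigma_algebra_preimage (hold p n)
  | Some (inr (p, n)) => g_sigma_algebra_preimage (dir p n)
  end.

(** The walks are independent continuous-time simple symmetric random walks
    with (total) jump rate [D], independent of the initial configuration. *)
Definition dla_walks : Prop :=
  [/\ mutually_independent P dla_sigma,
      (forall p n A, measurable A ->
         distribution P (hold p n) A = exponential_prob D A) &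
      (forall p n, P [set w | dir p n w = true] = (2^-1)%:E /\
                   P [set w | dir p n w = false] = (2^-1)%:E)].

Definition dla_R (t : R) (w : Omega) : \bar R :=
  dla_front (seq_of N w) (fun p n => hold p n w) (fun p n => dir p n w) t.

End dla_process.

(* Main.v *)
Require Import Defs.
From HB Require Import structures.
From mathcomp Require Import all_boot all_order all_algebra.
From mathcomp Require Import all_classical all_reals all_analysis.
From mathcomp Require Import measurable_realfun.
From mathcomp Require Import zify ring lra.
Import Order.TTheory GRing.Theory Num.Theory.
Import numFieldNormedType.Exports.

Set Implicit Arguments.
Unset Strict Implicit.
Unset Printing Implicit Defensive.

Local Open Scope classical_set_scope.
Local Open Scope ring_scope.

(** Each step of the process uses up one particle: the particle whose jump
    ends a step stood on the front site just before, so it turns black and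
    never ends a step again. Hence, once the front is at [k], at least [k]
    distinct particles have visited the sites up to [k]. It remains to see
    that there are fewer than [k] such visitors at a time of order [L ^ 2],
    when [k] is a large multiple of [L].

    Split the visitors according to their starting site, before or beyond a
    site [K] slightly larger than [k]. Since the mean density is less than one
    and [K / k] is close to one, the particles starting before [K] are fewer
    than [k] by a fixed proportion. What this takes is a linear bound on the
    partial sums of the initial configuration, which a maximal ergodic
    inequality gives ([ae_linearly_bounded]). The visitors starting beyond [K]
    have to travel a distance [K - k], a large multiple of [L], within a time
    [L ^ 2]. Given the initial configuration, the walks are independent and
    each of these particles has an exponentially small chance
    ([hit_weight_decay]), so that the conditional mean of the number of these
    visitors is a small multiple of [L] ([mild_of_bounded]), while the mean of
    its conditional variance is of order [L]. By the Chebyshev inequality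
    there are too many of them with a probability of order [1 / L]
    ([P_crowded]), which is summable along the powers of two. So, almost
    surely, the front at time [t] is at most a random multiple of [sqrt t]
    ([ae_dla_R_le_sqrt]), and the three conclusions follow.

    For the chance of travelling far, only one bit is kept of each holding
    time: whether it exceeds its median. A walk then becomes a sequence of
    pairs of fair coins, one for the slowness and one for the direction, its
    hitting probabilities obey a recursion ([hit_weight]), and a product of
    two geometric functions is superharmonic for this recursion.

    The first paragraph fails for trajectories with simultaneous jumps: a
    white particle that arrives at the new front site at the very moment when
    the front does stays white there; it can then slip behind the front and
    end many later steps. Holding times have no atoms, so this has probability zero
    ([ae_no_tie]). *)

(** * Jump times and absorbed particles *)

(** A list of largest size lists all the elements. *)
Lemma seq_cover_of_size_bound (T : choiceType) (A : set T) (k : nat) :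
    (forall s : seq T, uniq s -> (forall x, x \in s -> A x) -> (size s < k)%N) ->
  exists s : seq T, forall x, A x -> x \in s.
Proof.
move=> bounded; apply: contrapT => no_cover.
suff [s us [As szs]] : exists2 s : seq T, uniq s & (forall x, x \in s -> A x) /\ size s = k.
  by have := bounded s us As; rewrite szs ltnn.
elim: k {bounded} => [|k [s us [As szs]]]; first by exists [::].
have [x [Ax xs]] : exists x, A x /\ x \notin s.
  apply: contrapT => nx; apply: no_cover; exists s => x Ax.
  by apply: contrapT => /negP xs; apply: nx; exists x.
exists (x :: s); rewrite /= ?xs//; split; last by rewrite szs.
by move=> y; rewrite inE => /predU1P[->|/As].
Qed.

Lemma seq_cover_min (R : realDomainType) (l : seq R) (A : set R) (x : R) :
  A x -> (forall y, A y -> y \in l) -> exists2 m, A m & forall y, A y -> m <= y.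
Proof.
elim: l A x => [A x Ax /(_ _ Ax)//|z l IH A x Ax Al].
have [[y [Ay yz]]|none] := pselect (exists y, A y /\ y != z); last first.
  exists x => // y Ay; suff -> : y = x by [].
  have eqz v : A v -> v = z.
    by move=> Av; apply: contrapT => /eqP vz; apply: none; exists v.
  by rewrite (eqz y)// (eqz x).
have [||m [Am mz] mmin] := IH [set v | A v /\ v != z] y.
- by [].
- by move=> v [Av vz]; have := Al v Av; rewrite inE (negbTE vz).
have [Az|nAz] := pselect (A z).
  have [le_mz|lt_zm] := leP m z.
    by exists m => // v Av; case: (eqVneq v z) => [->//|vz]; apply: mmin.
  exists z => // v Av; case: (eqVneq v z) => [->//|vz].
  by apply: (le_trans (ltW lt_zm)); apply: mmin.
exists m => // v Av; apply: mmin; split => //.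
by apply: contra_notN nAz => /eqP <-.
Qed.

Section jump_times.
Context {R : realType} (h : nat -> R).

Lemma jump_time0 : jump_time h 0 = 0.
Proof. by rewrite /jump_time big_ord0. Qed.

Lemma jump_timeS n : jump_time h n.+1 = jump_time h n + h n.
Proof. by rewrite /jump_time big_ord_recr. Qed.

Hypothesis h_gt0 : forall m, 0 < h m.

Lemma jump_time_mono : {mono jump_time h : m n / (m <= n)%N >-> m <= n}.
Proof.
have incr : {homo jump_time h : m n / (m < n)%N >-> m < n}.
  by apply: (homo_ltn lt_trans) => i; rewrite jump_timeS ltrDl.
move=> m n; have [mn|nm] := leqP m n; last by rewrite leNgt incr.
by move: mn; rewrite leq_eqVlt => /predU1P[->|/incr/ltW->//]; rewrite lexx.
Qed.

Lemma jump_time_monolt : {mono jump_time h : m n / (m < n)%N >-> m < n}.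
Proof. by move=> m n; rewrite ltNge jump_time_mono -ltnNge. Qed.

End jump_times.

Section dla_path.
Context {R : realType} (eta : nat -> nat) (h : particle -> nat -> R)
        (b : particle -> nat -> bool).
Hypothesis h_gt0 : forall p m, 0 < h p m.
Hypothesis jump_time_unbounded : forall p t, exists n, t < jump_time (h p) n.
Hypothesis no_tie : forall p q n m, p != q ->
  jump_time (h p) n.+1 != jump_time (h q) m.+1.

Local Notation T p := (jump_time (h p)).
Local Notation pos p := (walk_pos (start p) (b p)).
Local Notation tau := (dla_tau eta h b).
Local Notation white k := ((dla_state eta h b k).2).

Definition visits (k : nat) (t : R) (p : particle) : Prop :=
  (p.2 < eta p.1)%N /\ exists n, T p n <= t /\ pos p n <= k%:Z.

Lemma walk_posS (x : int) d n :
  walk_pos x d n.+1 = walk_pos x d n + (if d n then 1 else -1).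
Proof. by rewrite /walk_pos big_ord_recr /= addrA. Qed.

(** Steps have size one, so no site is jumped over. *)
Lemma first_passage (x : int) d (k : int) n0 m : (n0 <= m)%N ->
  k < walk_pos x d n0 -> walk_pos x d m <= k ->
  exists n, [/\ (n0 <= n)%N, (n < m)%N & walk_pos x d n.+1 = k].
Proof.
elim: m => [|m IH]; first by rewrite leqn0 => /eqP ->; lia.
rewrite leq_eqVlt => /predU1P[->|]; first by lia.
rewrite ltnS => n0m k0 km; have [/(IH n0m k0)[n [? ? ?]]|km'] := leP (walk_pos x d m) k.
  by exists n; split => //; lia.
exists m; split => //; move: km; rewrite walk_posS; case: (d m); lia.
Qed.

Lemma jump_time_bracket p t : 0 <= t -> exists n, T p n <= t < T p n.+1.
Proof.
move=> t0; have [N tN] := jump_time_unbounded p t.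
elim: N tN => [|N IH]; first by rewrite jump_time0 ltNge t0.
by case: (leP (T p N) t) => [le1 lt2|lt1 _]; [exists N; rewrite le1|exact: IH].
Qed.

Lemma tauS_ge k : (tau k <= tau k.+1)%E.
Proof.
rewrite /dla_tau /=; case: (dla_state _ _ _ k) => s w /=.
by apply: le_ereal_inf_tmp => _ [t [st _] <-]; exact: ltW.
Qed.

Lemma tau_nd : {homo tau : m n / (m <= n)%N >-> (m <= n)%E}.
Proof. by apply: homo_leq => // [y x z|]; [exact: le_trans|exact: tauS_ge]. Qed.

Definition hit_times (k : nat) : set R := [set t : R | (tau k < t%:E)%E /\
  exists2 p, white k p & jumps_to (start p) (h p) (b p) k%:Z t].

Lemma tauS k : tau k.+1 = ereal_inf [set t%:E | t in hit_times k].
Proof.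
by rewrite /hit_times /dla_tau /=; case: (dla_state _ _ _ k) => s w.
Qed.

Lemma whiteS k : white k.+1 = white k `\`
  [set p | exists2 t : R, tau k.+1 = t%:E &
                  at_before (start p) (h p) (b p) k.+1%:Z t].
Proof. by rewrite /dla_tau /=; case: (dla_state _ _ _ k) => s w. Qed.

Lemma white_initial k p : white k p -> (p.2 < eta p.1)%N.
Proof. by elim: k => // k IH; rewrite whiteS => -[/IH]. Qed.

Section invariant.
Variables (K : nat) (t : R) (cover : seq particle).
Hypothesis coverP : forall p, visits K t p -> p \in cover.

(** Before [t], only the particles of the finite list [cover] can jump to [k],
    and each of them jumps finitely often, so the infimum is attained. *)
Lemma hit_times_min k : (k <= K)%N -> (tau k.+1 < t%:E)%E ->
  exists t0, [/\ tau k.+1 = t0%:E, hit_times k t0 &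
                 forall s, hit_times k s -> t0 <= s].
Proof.
move=> kK tau_t; pose A := hit_times k `&` [set s | s < t].
have [s1 As1] : exists s, A s.
  move: tau_t; rewrite tauS => /ereal_inf_lt[_ [s hs <-]]; rewrite lte_fin.
  by exists s.
have /choice[nmax nmaxP] := fun p => jump_time_unbounded p t.
pose l := flatten [seq [seq T p n | n <- iota 0 (nmax p)] | p <- cover].
have Al s : A s -> s \in l.
  move=> [[_ [p wp [n [sE posE]]]] /= st]; apply/flattenP.
  exists [seq T p n | n <- iota 0 (nmax p)]; last first.
    apply/mapP; exists n.+1 => //; rewrite mem_iota add0n leq0n/=.
    by rewrite -(jump_time_monolt (h_gt0 p)) -sE (lt_trans st).
  apply: map_f; apply: coverP; split; first exact: white_initial wp.
  by exists n.+1; rewrite -sE posE ltW// lez_nat.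
have [t0 [ht0 t0t] t0min] := seq_cover_min As1 Al.
have t0min' s : hit_times k s -> t0 <= s.
  move=> hs; have [st|ts] := ltP s t; first exact: t0min.
  by rewrite (le_trans (ltW t0t)).
exists t0; split => //; rewrite tauS; apply/le_anti/andP; split.
  by apply: ereal_inf_lbound; exists t0.
by apply: le_ereal_inf_tmp => _ [s hs <-]; rewrite lee_fin; exact: t0min'.
Qed.

(** By induction over the steps. The third clause, that white particles are
    beyond the front, forces the particle that ends a step to jump from the
    front site, hence to turn black at that time; the last clause collects
    these particles. *)
Lemma front_invariant k : (k <= K)%N -> (tau k < t%:E)%E ->
  exists t0, [/\ tau k = t0%:E, 0 <= t0,
    (forall p n, white k p -> T p n <= t0 < T p n.+1 -> k%:Z < pos p n) &
    exists s, [/\ uniq s, size s = k &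
                  forall p, p \in s -> visits K t p /\ ~ white k p]].
Proof.
elim: k => [_ t_gt0|k IH kK tau_t].
  exists 0; split => //; last by exists [::].
  move=> p [|n] _; first by rewrite /walk_pos big_ord0 addr0.
  by rewrite leNgt jump_timeS ltr_wpDl// -(jump_time0 (h p)) jump_time_mono.
have [||t0 [tauE t0_ge0 above [s [us szs sP]]]] := IH; first exact: ltnW.
  exact: le_lt_trans (tauS_ge k) tau_t.
have [t1 [tauSE [tau_t1 [p wp [n [t1E posp]]]] t1min]] :=
  hit_times_min (ltnW kK) tau_t.
move: tau_t1; rewrite tauE lte_fin => t01.
have t1t : t1 < t by move: tau_t; rewrite tauSE.
(* a first passage to [k] would be an earlier candidate for the infimum *)
have stays q m : white k q -> t0 < T q m.+1 -> T q m < t1 -> k%:Z < pos q m.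
  move=> wq t0m mt1; have [n0 n0P] := jump_time_bracket q t0_ge0.
  have posn0 := above _ _ wq n0P; have /andP[n0t0 t0n0] := n0P.
  have n0m : (n0 <= m)%N by rewrite -ltnS -(jump_time_monolt (h_gt0 q)) (le_lt_trans n0t0).
  rewrite ltNge; apply/negP => /(first_passage n0m posn0)[j [n0j jm posj]].
  have : t1 <= T q j.+1.
    apply: t1min; split; last by exists q => //; exists j.
    by rewrite tauE lte_fin (lt_le_trans t0n0)// jump_time_mono.
  by apply/negP; rewrite -ltNge (le_lt_trans _ mt1)// jump_time_mono.
have posn : pos p n = k.+1%:Z.
  have := stays p n wp; rewrite -t1E => /(_ t01).
  rewrite t1E jump_time_monolt// ltnSn => /(_ isT); move: posp.
  by rewrite walk_posS; case: (b p n); lia.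
have wpS : ~ white k.+1 p.
  rewrite whiteS => -[_]; apply; exists t1 => //; exists n; split=> //.
  by rewrite t1E lexx jump_time_monolt// ltnSn.
exists t1; split => //; first by rewrite (le_trans t0_ge0)// ltW.
  move=> q m wqS /andP[mt1 t1m]; have [wq nq] : white k q /\ ~ at_before (start q) (h q) (b q) k.+1%:Z t1.
    move: wqS; rewrite whiteS => -[wq nq]; split=> // ab; apply: nq; exists t1 => //.
  (* without ties, [q] does not jump at [t1], so it was beyond [k] just
     before; it is white, so it was not at [k.+1] *)
  have qp : p != q by apply: contra_notN wpS => /eqP ->.
  have mt1' : T q m < t1.
    rewrite lt_neqAle mt1 andbT; case: m {t1m mt1} => [|m].
      by rewrite jump_time0 lt_eqF// (le_lt_trans t0_ge0).
    by rewrite t1E eq_sym no_tie.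
  have := stays q m wq (lt_trans t01 t1m) mt1'.
  have : pos q m <> k.+1%:Z.
    by move=> e; apply: nq; exists m; rewrite mt1' ltW.
  by lia.
exists (p :: s); split => /=.
- by rewrite us andbT; apply/negP => /sP[].
- by rewrite szs.
- move=> q; rewrite inE => /predU1P[->|qs].
    split => //; split; first exact: white_initial wp.
    by exists n.+1; rewrite -t1E posp ltW// lez_nat ltnW.
  by have [vq nq] := sP q qs; split => //; rewrite whiteS => -[].
Qed.

End invariant.

Lemma tau_ge_of_few_visitors (k : nat) (t : R) :
    (forall s : seq particle, uniq s -> (forall p, p \in s -> visits k t p) ->
       (size s < k)%N) ->
  (t%:E <= tau k)%E.
Proof.
move=> few; rewrite leNgt; apply/negP => tau_t.
have [cover coverP] := @seq_cover_of_size_bound _ _ _ few.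
have [_ [_ _ _ [s [us szs sP]]]] := front_invariant coverP (leqnn k) tau_t.
by have := few s us (fun p ps => (sP p ps).1); rewrite szs ltnn.
Qed.

Lemma front_le_of_few_visitors (k : nat) (t s : R) : s < t ->
    (forall s : seq particle, uniq s -> (forall p, p \in s -> visits k t p) ->
       (size s < k)%N) ->
  (dla_front eta h b s <= k%:R%:E)%E.
Proof.
move=> st few; apply: ge_ereal_sup => _ [j /= js <-].
rewrite lee_fin ler_nat leqNgt; apply/negP => kj.
have := le_trans (le_trans (tau_ge_of_few_visitors few) (tau_nd (ltnW kj))) js.
by rewrite lee_fin leNgt st.
Qed.

End dla_path.

(** * Linear growth of the partial sums of an ergodic sequence *)
Section real_events.
Context d (T : measurableType d) (R : realType).

Lemma measurable_ler (f g : T -> R) :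
  measurable_fun setT f -> measurable_fun setT g -> measurable [set x | f x <= g x].
Proof.
move=> mf mg; rewrite -[X in measurable X]setTI.
exact: measurable_fun_le.
Qed.

Lemma measurable_ltr (f g : T -> R) :
  measurable_fun setT f -> measurable_fun setT g -> measurable [set x | f x < g x].
Proof.
move=> mf mg; have -> : [set x | f x < g x] = ~` [set x | g x <= f x].
  by apply/seteqP; split=> x /=; rewrite ltNge => /negP.
by apply: measurableC; exact: measurable_ler.
Qed.

End real_events.

Definition psum (x : nat -> nat) (m : nat) : nat := (\sum_(i < m) x i)%N.

Lemma psum_shift x m : psum x m.+1 = (x 0%N + psum (seq_shift x) m)%N.
Proof. by rewrite /psum big_ord_recl. Qed.

Section garsia.
Context {R : realType} (c : R).

(** The measurable sets of this type are, by definition, those of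
    [seq_measurable]: stationarity and ergodicity apply to them. *)
Definition seqT : Type := g_sigma_algebraType
  [set C | exists i k : nat, C = [set x : nat -> nat | x i = k]].
HB.instance Definition _ := Measurable.on seqT.

Definition linearly_bounded (x : seqT) : Prop :=
  exists M : nat, forall m, (psum x m)%:R <= c * m%:R + M%:R :> R.

Lemma measurable_coordinate i : measurable_fun setT (fun x : seqT => x i).
Proof.
move=> _ Y _; rewrite setTI.
have -> : (fun x : seqT => x i) @^-1` Y = \bigcup_(k in Y) [set x | x i = k].
  by apply/seteqP; split=> [x Yx|x [k Yk /= ->]//]; exists (x i).
apply: bigcup_measurable => k _; apply: sub_sigma_algebra.
by exists i, k.
Qed.

Lemma measurable_seq_shift : measurable_fun setT (seq_shift : seqT -> seqT).
Proof.
apply: (measurability _ (erefl (@measurable _ seqT))).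
move=> _ [_ [i [k ->]] <-]; rewrite setTI; apply: sub_sigma_algebra.
by exists i.+1, k.
Qed.

Lemma measurable_coordinateR i : measurable_fun setT (fun x : seqT => (x i)%:R : R).
Proof. by apply: measurableT_comp => //; exact: measurable_coordinate. Qed.

Lemma measurable_psum m : measurable_fun setT (fun x : seqT => (psum x m)%:R : R).
Proof.
rewrite (_ : (fun x => _) = fun x : seqT => \sum_(i < m) (x i)%:R).
  by apply: measurable_sum => i; exact: measurable_coordinateR.
by apply/funext => x; rewrite /psum natr_sum.
Qed.

Lemma measurable_linearly_bounded : measurable linearly_bounded.
Proof.
rewrite (_ : linearly_bounded = \bigcup_M \bigcap_m
   [set x : seqT | (psum x m)%:R <= c * m%:R + M%:R]); last first.
  apply/seteqP; split=> [x [M xM]|x [M _ xM]]; first by exists M => // m _; exact: xM.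
  by exists M => m; exact: xM.
apply: bigcup_measurable => M _; apply: bigcapT_measurable => m.
by apply: measurable_ler => //; exact: measurable_psum.
Qed.

(** The shift changes the excess over [c * m] by a bounded amount. The
    invariance is exact, as ergodicity demands; this is why the property is
    about bounded excesses and not about the averages [psum x m / m]. *)
Lemma linearly_bounded_shift (c_ge0 : 0 <= c) :
  seq_shift @^-1` linearly_bounded = linearly_bounded.
Proof.
apply/seteqP; split=> x [M xM] /=; last first.
  exists (M + `|Num.ceil c|)%N => m; have := xM m.+1.
  rewrite psum_shift !natrD -[m.+1]addn1 natrD mulrDr mulr1 => le1.
  have cc : c <= `|Num.ceil c|%:R.
    by rewrite natr_absz (le_trans (ceil_ge c))// ler_int ler_norm.
  have : 0 <= (x 0%N)%:R :> R by [].
  lra.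
exists (x 0%N + M)%N => -[|m].
  by rewrite /psum big_ord0 mulr0 add0r ler0n.
rewrite psum_shift !natrD -[m.+1]addn1 natrD mulrDr mulr1.
by have := xM m; lra.
Qed.

(** The maximum of [psum x j - c * j] over [j <= n], in the recursive form in
    which the shift appears. *)
Fixpoint max_excess (n : nat) (x : seqT) : R :=
  if n is n'.+1 then Num.max 0 ((x 0%N)%:R - c + max_excess n' (seq_shift x))
  else 0.

Lemma max_excess_ge0 n x : 0 <= max_excess n x.
Proof. by case: n => [|n] //=; rewrite le_max lexx. Qed.

Lemma max_excess_leS n x : max_excess n x <= max_excess n.+1 x.
Proof.
elim: n x => [|n IH] x; first exact: max_excess_ge0.
rewrite [leLHS]/= [leRHS]/= ge_max le_max lexx/= le_max; apply/orP; right.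
by rewrite lerD2l; exact: IH.
Qed.

Lemma psum_le_max_excess m x : (psum x m)%:R - c * m%:R <= max_excess m x.
Proof.
elim: m x => [|m IH] x; first by rewrite /psum big_ord0 mulr0 subr0.
rewrite [leRHS]/= le_max; apply/orP; right.
rewrite psum_shift -[m.+1]addn1 !natrD mulrDr mulr1.
have := IH (seq_shift x); lra.
Qed.

Lemma measurable_max_excess n : measurable_fun setT (max_excess n).
Proof.
elim: n => [|n IH] /=; first exact: measurable_cst.
apply: measurable_maxr; first exact: measurable_cst.
apply: measurable_funD.
  by apply: measurable_funB; [exact: measurable_coordinateR|exact: measurable_cst].
exact: (measurableT_comp IH measurable_seq_shift).
Qed.

Context d (Omega : measurableType d) (P : probability Omega R)
  (N : nat -> {mfun Omega >-> nat}).
Hypothesis N_stationary : stationary P N.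

Definition seqN : Omega -> seqT := seq_of N.

Lemma measurable_seqN : measurable_fun setT seqN.
Proof.
apply: (measurability _ (erefl (@measurable _ seqT))).
move=> _ [_ [i [k ->]] <-]; rewrite setTI.
rewrite (_ : _ @^-1` _ = N i @^-1` [set k])//.
by rewrite -[X in measurable X]setTI; exact: measurable_funP.
Qed.

Local Open Scope ereal_scope.

Lemma integral_shift (g : seqT -> \bar R) : measurable_fun setT g ->
  (forall x, 0 <= g x) -> \int[P]_w g (seq_shift (seqN w)) = \int[P]_w g (seqN w).
Proof.
move=> mg g0.
have mshift : measurable_fun setT (seq_shift \o seqN : Omega -> seqT).
  exact: (measurableT_comp measurable_seq_shift measurable_seqN).
have push := @ge0_integral_pushforward _ _ Omega seqT R _ _ P setT g measurableT mg.
transitivity (\int[pushforward P (seq_shift \o seqN : Omega -> seqT)]_y g y).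
  by rewrite (push _ mshift)// preimage_setT.
transitivity (\int[pushforward P seqN]_y g y).
  apply: eq_measure_integral => [|mN A mA _]; first exact: measurable_seqN.
  by have := N_stationary (A := A) mA; exact.
by rewrite (push _ measurable_seqN)// preimage_setT.
Qed.

Context (mu : R).
Hypothesis N_mean : 'E_P[fun w => (N 0%N w)%:R] = mu%:E.

Let mean : \int[P]_w (seqN w 0%N)%:R%:E = mu%:E.
Proof. by move: N_mean; rewrite unlock. Qed.

Let measurable_EFin_seqN (f : seqT -> R) : measurable_fun setT f ->
  measurable_fun setT (fun w => (f (seqN w))%:E).
Proof.
move=> mf; apply/measurable_EFinP.
exact: (measurableT_comp mf measurable_seqN).
Qed.

Let measurable_EFin_shift (f : seqT -> R) : measurable_fun setT f ->
  measurable_fun setT (fun w => (f (seq_shift (seqN w)))%:E).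
Proof.
move=> mf; apply: (@measurable_EFin_seqN (f \o seq_shift)).
exact: (measurableT_comp mf measurable_seq_shift).
Qed.

Lemma integral_max_excess_fin (c_ge0 : (0 <= c)%R) n :
  \int[P]_w (max_excess n (seqN w))%:E \is a fin_num.
Proof.
have mM k := measurable_EFin_seqN (measurable_max_excess k).
rewrite ge0_fin_numE; last first.
  by apply: integral_ge0 => w _; rewrite lee_fin max_excess_ge0.
elim: n => [|n IH]; first by rewrite /= integral0.
have msM := measurable_EFin_shift (measurable_max_excess n).
have m0 := measurable_EFin_seqN (measurable_coordinateR 0).
apply: (@le_lt_trans _ _ (\int[P]_w ((seqN w 0%N)%:R%:E +
    (max_excess n (seq_shift (seqN w)))%:E))).
  apply: ge0_le_integral => //.
  - by move=> w _; rewrite lee_fin max_excess_ge0.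
  - by apply: emeasurable_funD.
  - move=> w _; rewrite -EFinD lee_fin /= ge_max; apply/andP; split.
      by rewrite addr_ge0// max_excess_ge0.
    by rewrite lerD2r lerBlDr lerDl.
rewrite ge0_integralD//; last first.
  by move=> w _; rewrite lee_fin max_excess_ge0.
rewrite mean (@integral_shift (fun x => (max_excess n x)%:E)).
- by rewrite lte_add_pinfty// ltry.
- by apply/measurable_EFinP; exact: measurable_max_excess.
- by move=> x; rewrite lee_fin max_excess_ge0.
Qed.

(** Garsia's argument. Where it is positive, the maximum for [n.+1] is
    [x 0 - c] plus the maximum for [n] of the shifted sequence; elsewhere it
    is zero. By stationarity the shifted maximum for [n] has the same integral
    as the maximum for [n], which is at most that for [n.+1]. *)
Lemma maximal_ergodic (c_ge0 : (0 <= c)%R) n :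
  c%:E * P [set w | (0 < max_excess n (seqN w))%R] <= mu%:E.
Proof.
case: n => [|n].
  rewrite (_ : [set w | _] = set0) ?measure0 ?mule0; last first.
    by apply/seteqP; split=> // w /=; rewrite ltxx.
  by rewrite -mean; exact: integral_ge0.
set E := [set w | _].
have mM k := measurable_EFin_seqN (measurable_max_excess k).
have msM := measurable_EFin_shift (measurable_max_excess n).
have m0 := measurable_EFin_seqN (measurable_coordinateR 0).
have mE : measurable E.
  apply: measurable_ltr; first exact: measurable_cst.
  by have /measurable_EFinP := mM n.+1.
have M0 k w : 0 <= (max_excess k (seqN w))%:E by rewrite lee_fin max_excess_ge0.
have mI : measurable_fun setT (fun w => (\1_E w)%:E : \bar R).
  by apply/measurable_EFinP.
have key : \int[P]_w ((max_excess n.+1 (seqN w))%:E + c%:E * (\1_E w)%:E) <=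
  \int[P]_w ((seqN w 0%N)%:R%:E + (max_excess n (seq_shift (seqN w)))%:E).
  apply: ge0_le_integral => //.
  - by move=> w _; rewrite adde_ge0// mule_ge0// lee_fin.
  - by apply: emeasurable_funD => //; apply: measurable_funeM.
  - by apply: emeasurable_funD.
  - move=> w _; rewrite -EFinM -!EFinD lee_fin indicE.
    have [wE|wE] := boolP (w \in E); last first.
      rewrite mulr0 addr0; apply: (@le_trans _ _ 0%R).
        by rewrite leNgt; apply: contra wE => ?; rewrite inE.
      by rewrite addr_ge0// max_excess_ge0.
    move: wE; rewrite inE /E /= lt_max ltxx/= => gt0.
    by rewrite mulr1 maxEle (ltW gt0); lra.
have fin := integral_max_excess_fin c_ge0.
move: key; rewrite ge0_integralD//; last 2 first.
- by move=> w _; rewrite mule_ge0// lee_fin.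
- exact: measurable_funeM.
rewrite ge0_integralZl//.
rewrite integral_indic// setIT -[X in _ + _ * X <= _]/(P E) ge0_integralD//; last first.
  by move=> w _; rewrite lee_fin max_excess_ge0.
rewrite mean (@integral_shift (fun x => (max_excess n x)%:E)); last 2 first.
- by apply/measurable_EFinP; exact: measurable_max_excess.
- by move=> x; rewrite lee_fin max_excess_ge0.
have : \int[P]_w (max_excess n (seqN w))%:E <= \int[P]_w (max_excess n.+1 (seqN w))%:E.
  by apply: ge0_le_integral => // w _; rewrite lee_fin max_excess_leS.
have PEfin : P E \is a fin_num by exact: fin_num_measure.
move: (fin n) (fin n.+1) PEfin.
move: (\int[P]_w (max_excess n.+1 (seqN w))%:E) => [a| |] //.
move: (\int[P]_w (max_excess n (seqN w))%:E) => [b| |] //.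
move: (P E) => [p| |] // _ _ _.
by rewrite -!EFinM -!EFinD !lee_fin; lra.
Qed.

Hypothesis N_ergodic : ergodic P N.

(** The complementary event is invariant. On it some excess is positive, so
    if it had probability one, the maximal inequality would give [c <= mu] in
    the limit. *)
Lemma ae_linearly_bounded (mu_lt_c : (mu < c)%R) :
  {ae P, forall w, linearly_bounded (seq_of N w)}.
Proof.
have c_gt0 : (0 < c)%R.
  by apply: le_lt_trans mu_lt_c; rewrite -lee_fin -mean; exact: integral_ge0.
pose E n := [set w | (0 < max_excess n (seqN w))%R].
have mE n : measurable (E n).
  apply: measurable_ltr; first exact: measurable_cst.
  by apply/measurable_EFinP; exact: (measurable_EFin_seqN (measurable_max_excess n)).
pose A : set seqT := ~` linearly_bounded.
have mA : measurable A by apply: measurableC; exact: measurable_linearly_bounded.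
have mAN : measurable (seqN @^-1` A).
  by rewrite -[X in measurable X]setTI; exact: measurable_seqN.
have invA : seq_shift @^-1` A = A.
  by rewrite /A -[in RHS](linearly_bounded_shift (ltW c_gt0)).
suff PA0 : P (seqN @^-1` A) = 0.
  by exists (seqN @^-1` A); split.
have [//|PA1] := N_ergodic mA invA.
have sub : seqN @^-1` A `<=` \bigcup_n E n.
  move=> w nb; apply: contrapT => nE; apply: nb; exists 0%N => m.
  rewrite addr0 leNgt; apply/negP => lt1; apply: nE; exists m => //=.
  by apply: lt_le_trans (psum_le_max_excess _ _); rewrite subr_gt0.
have cvgE : P (E n) @[n --> \oo] --> P (\bigcup_n E n).
  apply: nondecreasing_cvg_mu => //; first exact: bigcup_measurable.
  apply/nondecreasing_seqP => n; apply/subsetPset => w /= /lt_le_trans; apply.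
  exact: max_excess_leS.
have PE : P (\bigcup_n E n) = 1.
  apply/le_anti/andP; split; first by apply: probability_le1; exact: bigcup_measurable.
  rewrite -PA1; apply: le_measure => //; rewrite inE//.
  exact: bigcup_measurable.
have : c%:E * 1 <= mu%:E.
  have cvgcE : c%:E * P (E n) @[n --> \oo] --> c%:E * 1.
    by rewrite -PE; exact: cvgeZl.
  rewrite -(cvg_lim _ cvgcE)//; apply: lime_le; first by apply/cvg_ex; eexists; exact: cvgcE.
  by apply: nearW => n; apply: maximal_ergodic; exact: ltW.
by rewrite mule1 lee_fin leNgt mu_lt_c.
Qed.

End garsia.

(** * Hitting probabilities of a discretised walk *)

(** Read from the index [m] on, for at most [n] steps, do the coins lead from
    the height [g] to the height zero before more than [r] of the [c] are
    true? A true [b] is a step up. A true [c] marks a step that costs one unit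
    of the time budget [r]; the other steps are free. *)
Fixpoint hits (c b : nat -> bool) (n m g r : nat) : bool :=
  (g == 0)%N || (if n is n'.+1 then
    let g' := if b m then g.+1 else g.-1 in
    if c m then (if r is r'.+1 then hits c b n' m.+1 g' r' else false)
    else hits c b n' m.+1 g' r
  else false).

Lemma hitsS c b n m g r : hits c b n.+1 m g r = (g == 0)%N ||
  (let g' := if b m then g.+1 else g.-1 in
   if c m then (if r is r'.+1 then hits c b n m.+1 g' r' else false)
   else hits c b n m.+1 g' r).
Proof. by []. Qed.

Lemma hits_leS c b n m g r : hits c b n m g r -> hits c b n.+1 m g r.
Proof.
elim: n m g r => [|n IH] m g r; first by rewrite /= !orbF => ->.
rewrite hitsS [in X in _ -> X]hitsS; case: (g == 0)%N => //=.
by case: (c m); [case: r => // r|]; exact: IH.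
Qed.

Lemma hits_of_path (c b : nat -> bool) n m g r j : (j <= n)%N ->
  (\sum_(i < j) c (m + i) <= r)%N ->
  g%:Z + \sum_(i < j) (if b (m + i)%N then 1 else -1) <= 0 ->
  hits c b n m g r.
Proof.
elim: n m g r j => [|n IH] m g r [|j] //=; rewrite ?big_ord0 ?orbF.
- by move=> _ _; rewrite addr0; lia.
- by move=> _ _; rewrite addr0 => g0; apply/orP; left; lia.
rewrite ltnS => jn; rewrite !big_ord_recl /= addn0 => cr gb.
case: (eqVneq g 0%N) => //= g0.
set g' := if b m then _ else _.
have gb' : g'%:Z + \sum_(i < j) (if b (m.+1 + i)%N then 1 else -1) <= 0.
  move: gb; rewrite addrA (_ : g%:Z + _ = g'%:Z); last first.
    by rewrite /g'; case: (b m); lia.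
  by under [X in _ -> _ + X <= _]eq_bigr do rewrite addSnnS.
have cr' : (c m + \sum_(i < j) c (m.+1 + i) <= r)%N.
  by under eq_bigr do rewrite addSnnS.
move: cr'; case: (c m) => [|cr']; last exact: IH jn cr' gb'.
by case: r {cr} => // r; rewrite add1n ltnS => cr'; exact: IH jn cr' gb'.
Qed.

Section hit_weight.
Context {R : realFieldType}.

(** The probability of [hits] when all the coins are fair and independent. *)
Fixpoint hit_weight (n g r : nat) : R :=
  if g is g'.+1 then
    if n is n'.+1 then
      ((if r is r'.+1 then hit_weight n' g.+1 r' + hit_weight n' g' r' else 0)
       + (hit_weight n' g.+1 r + hit_weight n' g' r)) / 4
    else 0
  else 1.

Lemma hit_weight_ge0 n g r : 0 <= hit_weight n g r.
Proof.
elim: n g r => [|n IH] [|g] r //=; rewrite divr_ge0// !addr_ge0//.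
by case: r => [|r] //; rewrite addr_ge0.
Qed.

(** The inequality between [x] and [y] says that [x ^+ g * y ^+ r.+1] is
    superharmonic for the recursion, and this function is at least [1] at
    [g = 0]. The exponent [r.+1], and not [r], keeps natural the exponent that
    stands for one unit below the budget [r = 0]. *)
Lemma hit_weight_le (x y : R) n g r : 0 < x -> 1 <= y ->
  (1 + x ^+ 2) * (1 + y) <= 4 * (x * y) ->
  hit_weight n g r <= x ^+ g * y ^+ r.+1.
Proof.
move=> x0 y1 xy; have y0 : 0 < y by lra.
have pos g' r' : 0 <= x ^+ g' * y ^+ r' by rewrite mulr_ge0 ?exprn_ge0// ltW.
elim: n g r => [|n IH] [|g] r /=; rewrite ?expr0 ?mul1r ?exprn_ege1//.
have step : (if r is r'.+1 then hit_weight n g.+2 r' + hit_weight n g r' else 0) <=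
    x ^+ g * (x ^+ 2 + 1) * y ^+ r.
  case: r => [|r]; first by rewrite expr0 mulr1 mulr_ge0 ?addr_ge0 ?exprn_ge0// ltW.
  by have := IH g.+2 r; have := IH g r; rewrite !exprSr; lra.
have := IH g.+2 r; have := IH g r.
have /(ler_wpM2l (pos g r)) := xy.
move: step; rewrite !(exprSr x) !(exprSr y) expr0 mul1r.
set a := x ^+ g; set e := y ^+ r; set s := (if _ is _.+1 then _ else _); lra.
Qed.

End hit_weight.

Section cylinder.
Context {R : realType} d {Omega : measurableType d} (P : probability Omega R).

Definition pr (A : set Omega) : R := fine (P A).

Lemma prE A : measurable A -> P A = (pr A)%:E.
Proof. by move=> mA; rewrite /pr fineK// fin_num_measure. Qed.

Lemma pr_ge0 A : 0 <= pr A. Proof. by rewrite /pr fine_ge0. Qed.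

Lemma pr0 : pr set0 = 0. Proof. by rewrite /pr measure0. Qed.

Lemma le_pr A B : measurable A -> measurable B -> A `<=` B -> pr A <= pr B.
Proof.
by move=> mA mB AB; rewrite -lee_fin -!prE//; apply: le_measure; rewrite ?inE.
Qed.

Lemma pr_split A B : measurable A -> measurable B ->
  pr A = pr (A `&` B) + pr (A `&` ~` B).
Proof.
move=> mA mB; have mI := measurableI _ _ mA mB.
have mD : measurable (A `&` ~` B) by apply: measurableI => //; exact: measurableC.
apply: EFin_inj; rewrite EFinD -!prE// -measureU//.
  by rewrite -setIUr setUv setIT.
by apply/seteqP; split => // w [[_ ?] [_]].
Qed.

Lemma measurable_pred (f : Omega -> bool) : measurable_fun setT f -> measurable [set w | f w].
Proof. by move=> mf; rewrite -[X in measurable X]setTI; exact: mf. Qed.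

Lemma measurable_boolval (f : Omega -> bool) v :
  measurable_fun setT f -> measurable [set w | f w = v].
Proof.
by move=> mf; rewrite -[X in measurable X]setTI; apply: (mf measurableT [set v]).
Qed.

Variables (c b : nat -> Omega -> bool).
Hypotheses (mc : forall i, measurable_fun setT (c i))
           (mb : forall i, measurable_fun setT (b i)).

Definition cylinder (m k : nat) (v : nat -> bool * bool) : set Omega :=
  [set w | forall i, (i < k)%N -> (c (m + i)%N w, b (m + i)%N w) = v i].

Lemma measurable_cylinder m k v : measurable (cylinder m k v).
Proof.
rewrite (_ : cylinder m k v = \bigcap_(i in [set i | (i < k)%N])
    ([set w | c (m + i)%N w = (v i).1] `&` [set w | b (m + i)%N w = (v i).2])).
  by apply: bigcap_measurableType => i _; apply: measurableI; exact: measurable_boolval.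
apply/seteqP; split => w /= all i ik; first by rewrite -all.
by have [/= -> ->] := all i ik; rewrite -surjective_pairing.
Qed.

(** The coins of index at least [m] are fair and independent of [B]. This only
    involves finitely many coins at a time and passes from [B] to its
    intersection with an outcome of the coins of index [m], so it supports an
    induction over the steps without any generated sigma-algebra. *)
Definition fair_future (m : nat) (B : set Omega) : Prop :=
  measurable B /\ forall k v, pr (B `&` cylinder m k v) = pr B / 4 ^+ k.

Definition hit_event n m g r : set Omega :=
  [set w | hits (c^~ w) (b^~ w) n m g r].

Lemma measurable_hit_event n m g r : measurable (hit_event n m g r).
Proof.
apply: measurable_pred; elim: n m g r => [|n IH] m g r /=.
  exact: measurable_cst.
have mstep r' : measurable_fun setT (fun w =>
    hits (c^~ w) (b^~ w) n m.+1 (if b m w then g.+1 else g.-1) r').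
  rewrite (_ : (fun w => _) = fun w => if b m w
    then hits (c^~ w) (b^~ w) n m.+1 g.+1 r'
    else hits (c^~ w) (b^~ w) n m.+1 g.-1 r'); last first.
    by apply/funext => w; case: (b m w).
  exact: measurable_fun_ifT.
apply: measurable_or; first exact: measurable_cst.
apply: measurable_fun_ifT => //.
by case: r => [|r]; [exact: measurable_cst|exact: mstep].
Qed.

Lemma fair_future_step m B (a : bool * bool) : fair_future m B ->
  fair_future m.+1 (B `&` [set w | (c m w, b m w) = a]) /\
  pr (B `&` [set w | (c m w, b m w) = a]) = pr B / 4.
Proof.
move=> [mB fB]; pose E := [set w | (c m w, b m w) = a].
have cyl1 : E = cylinder m 1 (fun=> a).
  apply/seteqP; split => w /=; last by move/(_ 0%N isT); rewrite addn0.
  by move=> e [|//] _; rewrite addn0.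
have prE1 : pr (B `&` E) = pr B / 4 by rewrite cyl1 fB expr1.
split => //; split.
  apply: measurableI => //; rewrite (_ : [set w | _] =
    [set w | c m w = a.1] `&` [set w | b m w = a.2]).
    by apply: measurableI; exact: measurable_boolval.
  by case: a {E cyl1 prE1} => a1 a2; apply/seteqP; split => w /= [-> ->].
move=> k v; rewrite prE1 -mulrA -invfM -exprS -(fB k.+1 (fun i => if i is i'.+1 then v i' else a)).
congr pr; rewrite -setIA; congr (_ `&` _); apply/seteqP; split => w /=.
  by move=> [e ev] [_|i]; rewrite ?addn0// ltnS addnS -addSn => /ev.
by move=> ev; split=> [|i ik]; [have := ev 0%N isT; rewrite addn0|have := ev i.+1 ik; rewrite addnS -addSn].
Qed.

(** Condition on the four outcomes of the coins of index [m]. *)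
Lemma pr_hit_event m B n g r : fair_future m B ->
  pr (B `&` hit_event n m g r) = pr B * hit_weight n g r.
Proof.
elim: n m B g r => [|n IH] m B g r fB.
  rewrite /hit_event /=; case: g => [|g] /=.
    by rewrite (_ : [set w | _] = setT) ?setIT ?mulr1//; apply/seteqP; split.
  by rewrite (_ : [set w | _] = set0) ?setI0 ?pr0 ?mulr0//; apply/seteqP; split.
case: g => [|g].
  by rewrite (_ : hit_event n.+1 m 0 r = setT) ?setIT ?mulr1//; apply/seteqP; split.
have [mB _] := fB.
pose X a := [set w | (c m w, b m w) = a].
pose next (a : bool * bool) := let g' := if a.2 then g.+2 else g in
  if a.1 then (if r is r'.+1 then hit_event n m.+1 g' r' else set0)
  else hit_event n m.+1 g' r.
pose weight (a : bool * bool) : R := let g' := if a.2 then g.+2 else g in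
  if a.1 then (if r is r'.+1 then hit_weight n g' r' else 0)
  else hit_weight n g' r.
set H := hit_event n.+1 m g.+1 r.
have piece a : pr (B `&` H `&` X a) = pr B / 4 * weight a.
  have [fBa <-] := fair_future_step a fB.
  rewrite (_ : _ `&` X a = (B `&` X a) `&` next a).
    rewrite /next /weight; case: a fBa => [[] a2] fBa /=; last exact: IH.
    by case: r {H next weight} => [|r]; [rewrite setI0 pr0 mulr0|exact: IH].
  rewrite setIAC -!setIA; congr (_ `&` _); apply/seteqP; split => w [] /=.
    move=> Xa; rewrite /H /hit_event /= => Hw; split => //; move: Hw; rewrite /next -Xa /=.
    by case: (c m w); case: (b m w); case: r {H next weight}.
  move=> Xa; rewrite /next -Xa => Hw; split => //; move: Hw; rewrite /H /hit_event /=.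
  by case: (c m w); case: (b m w); case: r {H next weight}.
pose E1 := [set w | c m w]; pose E2 := [set w | b m w].
have mE1 : measurable E1 by exact: measurable_pred.
have mE2 : measurable E2 by exact: measurable_pred.
have mBH : measurable (B `&` H) by apply: measurableI => //; exact: measurable_hit_event.
rewrite (pr_split mBH mE1) (pr_split (measurableI _ _ mBH mE1) mE2).
rewrite (pr_split (measurableI _ _ mBH (measurableC mE1)) mE2).
rewrite (_ : _ `&` E1 `&` E2 = B `&` H `&` X (true, true)); last first.
  rewrite -setIA; congr (_ `&` _); apply/seteqP; split=> w; rewrite /E1 /E2 /X /=.
    by case=> -> ->.
  by case=> -> ->.
rewrite (_ : _ `&` E1 `&` ~` E2 = B `&` H `&` X (true, false)); last first.
  rewrite -setIA; congr (_ `&` _); apply/seteqP; split=> w; rewrite /E1 /E2 /X /=.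
    by case=> -> /negP/negbTE ->.
  by case=> -> ->.
rewrite (_ : _ `&` ~` E1 `&` E2 = B `&` H `&` X (false, true)); last first.
  rewrite -setIA; congr (_ `&` _); apply/seteqP; split=> w; rewrite /E1 /E2 /X /=.
    by case=> /negP/negbTE -> ->.
  by case=> -> ->.
rewrite (_ : _ `&` ~` E1 `&` ~` E2 = B `&` H `&` X (false, false)); last first.
  rewrite -setIA; congr (_ `&` _); apply/seteqP; split=> w; rewrite /E1 /E2 /X /=.
    by case=> /negP/negbTE -> /negP/negbTE ->.
  by case=> -> ->.
rewrite !piece /weight /=; case: r {H next weight piece mBH} => [|r]; lra.
Qed.

End cylinder.

(** * The exponential law and a second moment bound *)
Section exponential.
Context {R : realType} (D : R) (D_gt0 : 0 < D).
Local Open Scope ereal_scope.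

(** The density is at most [D]. *)
Lemma exponential_prob_le A : measurable A ->
  exponential_prob D A <= D%:E * lebesgue_measure A.
Proof.
move=> mA; rewrite /exponential_prob -integral_cst//.
apply: ge0_le_integral => //.
- by move=> x _; rewrite lee_fin exponential_pdf_ge0// ltW.
- apply/measurable_EFinP; apply: measurable_funTS; exact: measurable_exponential_pdf.
- move=> x _; rewrite lee_fin; have [x0|x0] := ltP x 0%R.
    by rewrite lt0_exponential_pdf// ltW.
  rewrite exponential_pdfE// ler_piMr//; first exact: ltW.
  by rewrite expR_le1 mulNr oppr_le0 mulr_ge0// ltW.
Qed.

Lemma exponential_prob_lt0 : exponential_prob D `]-oo, 0%R[ = 0.
Proof.
rewrite /exponential_prob integral0_eq// => x /=; rewrite in_itv/= => x0.
by rewrite lt0_exponential_pdf.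
Qed.

Lemma exponential_prob_le0 : exponential_prob D `]-oo, 0%R] = 0.
Proof.
rewrite -(@setUitv1 _ R -oo%O 0%R true)//.
rewrite [LHS](@measureU _ _ _ (exponential_prob D))//.
  rewrite [X in X + _]exponential_prob_lt0 add0e; apply/le_anti/andP; split => //.
  by rewrite (le_trans (exponential_prob_le _))// lebesgue_measure_set1 mule0.
by apply/seteqP; split => x //= []; rewrite in_itv/= => /[swap] ->; rewrite ltxx.
Qed.

Lemma exponential_prob_gt (x : R) : (0 < x)%R ->
  exponential_prob D `]x, +oo[ = (expR (- D * x))%:E.
Proof.
move=> x0.
have split_ge0 : exponential_prob D (`]-oo, 0%R[ `|` `[0%R, x] `|` `]x, +oo[) = 1.
  rewrite (_ : _ `|` _ = setT); first exact: probability_setT.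
  apply/seteqP; split => // y _ /=; rewrite !in_itv/=.
  by case: (ltP y 0%R) => y0; [left; left|case: (leP y x) => yx; [left; right|right]; rewrite ?andbT].
move: split_ge0; rewrite (@measureU _ _ _ (exponential_prob D))//; first last.
- apply/seteqP; split => y //= [[]]; rewrite !in_itv/= => h1 /andP[h2 _].
    by move: (lt_trans h2 (lt_trans h1 x0)); rewrite ltxx.
  by move/andP: h1 => [_ /(lt_le_trans h2)]; rewrite ltxx.
- exact: measurableU.
rewrite (@measureU _ _ _ (exponential_prob D))//; last first.
  by apply/seteqP; split => y //= []; rewrite !in_itv/= => y0 /andP[/(lt_le_trans y0)]; rewrite ltxx.
rewrite [X in X + _ + _]exponential_prob_lt0 add0e [X in X + _]exponential_prob_itv0c// => e1.
have fin : exponential_prob D `]x, +oo[ \is a fin_num by exact: fin_num_measure.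
have {}e1 : 1 - (expR (- D * x))%:E + exponential_prob D `]x, +oo[ = 1 by exact: e1.
move: fin e1.
case: (exponential_prob D `]x, +oo[) => [y| |] // _.
by rewrite -EFinB -EFinD => -[e1]; congr EFin; lra.
Qed.

End exponential.

Section moments.
Context {R : realType} d {Omega : measurableType d} (P : probability Omega R).

Lemma integrable_comb4 (A B C E : set Omega) (x y z t : R) :
  measurable A -> measurable B -> measurable C -> measurable E ->
  P.-integrable setT (EFin \o (fun w => x * \1_A w + y * \1_B w + z * \1_C w + t * \1_E w)) /\
  \int[P]_w (x * \1_A w + y * \1_B w + z * \1_C w + t * \1_E w) =
  x * pr P A + y * pr P B + z * pr P C + t * pr P E.
Proof.
move=> mA mB mC mE.
have int1 X v : measurable X ->
    P.-integrable setT (EFin \o (fun w => v * \1_X w)) /\ \int[P]_w (v * \1_X w) = v * pr P X.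
  move=> mX; have iX := integrable_indic P mX; split.
    exact: (integrableZl measurableT v iX).
  by rewrite RintegralZl// /Rintegral integral_indic// setIT.
have intD f g u v : P.-integrable setT (EFin \o f) /\ \int[P]_w f w = u ->
    P.-integrable setT (EFin \o g) /\ \int[P]_w g w = v ->
    P.-integrable setT (EFin \o (fun w => f w + g w)) /\ \int[P]_w (f w + g w) = u + v.
  move=> [if_ <-] [ig <-]; split; last by rewrite RintegralD.
  exact: (integrableD measurableT if_ ig).
by do ![exact: int1|apply: (intD _ _ _ _)].
Qed.

Lemma Rintegral_sum (I : Type) (s : seq I) (f : I -> Omega -> R) :
  (forall i, P.-integrable setT (EFin \o f i)) ->
  P.-integrable setT (EFin \o (fun w => \sum_(i <- s) f i w)) /\
  \int[P]_w (\sum_(i <- s) f i w) = \sum_(i <- s) \int[P]_w f i w.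
Proof.
move=> intf; elim: s => [|i s [IH1 IH2]].
  rewrite big_nil; split.
    rewrite (_ : EFin \o _ = cst 0%E); first exact: integrable0.
    by apply/funext => w; rewrite /= big_nil.
  by under eq_Rintegral do rewrite big_nil; rewrite Rintegral_cst// mul0r.
split.
  rewrite (_ : EFin \o _ = (EFin \o f i) \+ (EFin \o (fun w => (\sum_(j <- s) f j w)%R)))%E.
    exact: integrableD.
  by apply/funext => w; rewrite /= big_cons EFinD.
under eq_Rintegral do rewrite big_cons.
by rewrite RintegralD// IH2 big_cons.
Qed.

(** Think of [B i] as the presence of [i] and of [u i] as the probability of
    [H i] given all the presences. Centering by this conditional mean cancels
    the terms [i != j] of the second moment whatever the joint law of the
    presences. *)
Lemma chebyshev_sum (I : eqType) (s : seq I) (B H : I -> set Omega) (u : I -> R) (a : R) :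
  (forall i, measurable (B i)) -> (forall i, measurable (H i)) ->
  (forall i, 0 <= u i) -> uniq s -> 0 < a ->
  (forall i, pr P (B i `&` H i) = pr P (B i) * u i) ->
  (forall i j, i != j -> pr P (B i `&` B j `&` H i) = pr P (B i `&` B j) * u i /\
     pr P (B i `&` B j `&` H j `&` H i) = pr P (B i `&` B j) * u j * u i) ->
  pr P [set w | a <= \sum_(i <- s) \1_(B i) w * (\1_(H i) w - u i)] <=
  (\sum_(i <- s) pr P (B i) * u i) / a ^+ 2.
Proof.
move=> mB mH u0 us a0 PBH PBBHH.
pose Z i w : R := \1_(B i) w * (\1_(H i) w - u i).
have mBH i : measurable (B i `&` H i) by exact: measurableI.
have ZZE i j w : Z i w * Z j w =
    1 * \1_(B i `&` B j `&` H j `&` H i) w + (- u j) * \1_(B i `&` B j `&` H i) w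
    + (- u i) * \1_(B j `&` B i `&` H j) w + (u i * u j) * \1_(B i `&` B j) w.
  by rewrite /Z !indicI/=; ring.
have mBB i j : measurable (B i `&` B j) by exact: measurableI.
have mBBH i j k : measurable (B i `&` B j `&` H k) by exact: measurableI.
have mBBHH i j k l : measurable (B i `&` B j `&` H k `&` H l) by exact: measurableI.
have ZZ i j : P.-integrable setT (EFin \o (fun w => Z i w * Z j w)) /\
    \int[P]_w (Z i w * Z j w) <= if i == j then pr P (B i) * u i else 0.
  have [int1 int2] := integrable_comb4 1 (- u j) (- u i) (u i * u j)
    (mBBHH i j j i) (mBBH i j i) (mBBH j i j) (mBB i j).
  split; first by rewrite (funext (ZZE i j)).
  under eq_Rintegral do rewrite ZZE; rewrite int2; case: eqVneq => [<-|ij].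
    rewrite !setIid -setIA setIid PBH; have := pr_ge0 P (B i); have := u0 i.
    move=> ? ?; rewrite -subr_ge0.
    rewrite [leRHS](_ : _ = pr P (B i) * u i ^+ 2); last by ring.
    by rewrite mulr_ge0// sqr_ge0.
  have ji : j != i by rewrite eq_sym.
  have [e1 e2] := PBBHH _ _ ij; have [e3 _] := PBBHH _ _ ji.
  by rewrite e1 e2 e3 (setIC (B j)) le_eqVlt; apply/orP; left; apply/eqP; ring.
pose S w := \sum_(i <- s) Z i w.
have SSE w : S w ^+ 2 = \sum_(i <- s) \sum_(j <- s) Z i w * Z j w.
  by rewrite expr2 {1}/S mulr_suml; apply: eq_bigr => i _; rewrite mulr_sumr.
have intSS : P.-integrable setT (EFin \o (fun w => S w ^+ 2)) /\
    \int[P]_w (S w ^+ 2) = \sum_(i <- s) \sum_(j <- s) \int[P]_w (Z i w * Z j w).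
  have inner i := Rintegral_sum s (fun j => (ZZ i j).1).
  have [int1 int2] := Rintegral_sum s (fun i => (inner i).1).
  split; first by rewrite (funext SSE).
  under eq_Rintegral do rewrite SSE; rewrite int2.
  by apply: eq_bigr => i _; exact: (inner i).2.
have mS : measurable_fun setT S.
  apply: measurable_sum => i; apply: measurable_funM; first exact: measurable_indic.
  by apply: measurable_funB; [exact: measurable_indic|exact: measurable_cst].
have mA : measurable [set w | a <= S w] by apply: measurable_ler => //; exact: measurable_cst.
rewrite ler_pdivlMr ?exprn_gt0//.
apply: (@le_trans _ _ (\int[P]_w (S w ^+ 2))).
  have intA := integrable_indic P mA.
  rewrite [leLHS](_ : _ = \int[P]_w (\1_[set w | a <= S w] w * a ^+ 2)); last first.
    by rewrite RintegralZr// /Rintegral integral_indic// setIT.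
  apply: le_Rintegral => //; last 2 first.
  - exact: intSS.1.
  - move=> w _; rewrite indicE; case: (boolP (w \in _)) => [|_]; last by rewrite mul0r sqr_ge0.
    rewrite inE /= mul1r => aS; rewrite ler_sqr ?nnegrE//; first exact: ltW.
    exact: le_trans (ltW a0) aS.
  exact: (integrableZr measurableT (a ^+ 2) intA).
rewrite intSS.2; rewrite big_seq [leRHS]big_seq; apply: ler_sum => i si.
rewrite (bigD1_seq i)//=; have := (ZZ i i).2; rewrite eqxx => le1.
rewrite -[leRHS]addr0; apply: lerD => //; apply: sumr_le0 => j ji.
by have := (ZZ i j).2; rewrite eq_sym (negbTE ji).
Qed.

End moments.

(** * Independence of the walks *)
Section walks.
Context {R : realType} {d : measure_display} {Omega : measurableType d}
  (P : probability Omega R) (D : R)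
  (N : nat -> {mfun Omega >-> nat})
  (hold : particle -> nat -> {RV P >-> R})
  (dir : particle -> nat -> {RV P >-> bool}).
Hypotheses (D_gt0 : 0 < D) (walks : dla_walks D N hold dir).

Definition median : R := ln 2 / D.

Lemma median_gt0 : 0 < median.
Proof. by rewrite divr_gt0// ln_gt0// ltr1n. Qed.

Definition slow (p : particle) (i : nat) (w : Omega) : bool := median < hold p i w.

Lemma measurable_hold p i : measurable_fun setT (hold p i).
Proof. by []. Qed.

Lemma measurable_slow p i : measurable_fun setT (slow p i).
Proof. by apply: measurable_fun_ltr => //; exact: measurable_cst. Qed.

Lemma measurable_dir p i : measurable_fun setT (dir p i).
Proof. by []. Qed.

Lemma P_hold p i A : measurable A -> P (hold p i @^-1` A) = exponential_prob D A.
Proof. by case: walks => _ + _; apply. Qed.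

Lemma pr_slow p i v : P [set w | slow p i w = v] = (2^-1)%:E.
Proof.
have slowE : [set w | slow p i w = true] = hold p i @^-1` `]median, +oo[.
  by apply/seteqP; split => w /=; rewrite in_itv/= andbT.
have half : P [set w | slow p i w = true] = (2^-1)%:E.
  rewrite slowE P_hold// exponential_prob_gt ?median_gt0//.
  by rewrite /median mulNr mulrCA mulfV ?gt_eqF// mulr1 expRN lnK ?posrE.
case: v => //; rewrite (_ : [set w | _] = ~` [set w | slow p i w = true]).
  rewrite probability_setC; last by apply: measurable_boolval; exact: measurable_slow.
  by rewrite half -EFinB; congr EFin; lra.
by apply/seteqP; split => w /=; case: slow.
Qed.

Lemma pr_dir p i v : P [set w | dir p i w = v] = (2^-1)%:E.
Proof. by case: walks => _ _ /(_ p i)[h1 h2]; case: v. Qed.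

Definition initial_event (B : set Omega) : Prop := dla_sigma N hold dir None B.

Lemma measurable_initial_event B : initial_event B -> measurable B.
Proof. by move=> [C mC <-]; exact: (measurable_seqN N measurableT mC). Qed.

Definition coin p i w : bool * bool := (slow p i w, dir p i w).

Lemma prod_half (T : Type) (s : seq T) :
  (\prod_(x <- s) (2^-1)%:E = ((2 ^+ size s)^-1)%:E :> \bar R)%E.
Proof.
elim: s => [|x s IH]; first by rewrite big_nil expr0 invr1.
by rewrite big_cons IH -EFinM exprS invfM.
Qed.

Lemma pr_coins B (s : seq (particle * nat)) (v : particle * nat -> bool * bool) :
  initial_event B -> uniq s ->
  pr P (B `&` [set w | forall x, x \in s -> coin x.1 x.2 w = v x]) =
  pr P B / 4 ^+ size s.
Proof.
move=> iB us; have [indep _ _] := walks.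
pose I : eqType := option ((particle * nat) + (particle * nat))%type.
pose l : seq I := None :: [seq Some (inl x) | x <- s] ++ [seq Some (inr x) | x <- s].
pose A (i : I) : set Omega := match i with
  | None => B
  | Some (inl x) => [set w | slow x.1 x.2 w = (v x).1]
  | Some (inr x) => [set w | dir x.1 x.2 w = (v x).2]
  end.
have inj1 : injective (fun x : particle * nat => Some (inl x) : I) by move=> ? ? [].
have inj2 : injective (fun x : particle * nat => Some (inr x) : I) by move=> ? ? [].
have ul : uniq l.
  rewrite /l /= cat_uniq !map_inj_uniq// us/= andbT mem_cat negb_or.
  apply/andP; split; last by apply/hasPn => _ /mapP[x _ ->]; apply/mapP => -[].
  by apply/andP; split; apply/mapP => -[].
have Al i : i \in l -> dla_sigma N hold dir i (A i).
  rewrite inE mem_cat => /orP[/eqP ->//|/orP[]] /mapP[[p k] _ ->] /=.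
    exists [set r | (median < r) = (v (p, k)).1]; last by rewrite setTI.
    by apply: measurable_boolval; apply: measurable_fun_ltr => //; exact: measurable_cst.
  by exists [set r | r = (v (p, k)).2]; last by rewrite setTI.
have := indep l A ul Al.
rewrite (_ : \bigcap_(i in [set` l]) A i =
    B `&` [set w | forall x, x \in s -> coin x.1 x.2 w = v x]); last first.
  apply/seteqP; split => w /=.
    move=> all; split; first by apply: (all None); rewrite /= inE.
    move=> x xs.
    have lx : (Some (inl x) : I) \in l by rewrite inE mem_cat map_f ?orbT.
    have rx : (Some (inr x) : I) \in l.
      by rewrite inE mem_cat [X in _ || (_ || X)]map_f ?orbT.
    have /= h1 := all _ lx; have /= h2 := all _ rx.
    by rewrite /coin h1 h2 -surjective_pairing.
  move=> [Bw all] i /=; rewrite inE mem_cat => /orP[/eqP ->//|/orP[]] /mapP[x xs ->] /=.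
    by rewrite -(all x xs).
  by rewrite -(all x xs).
rewrite big_cons big_cat !big_map /=.
rewrite (eq_bigr (fun=> (2^-1)%:E)); last by move=> x _; exact: pr_slow.
rewrite [X in (_ * (_ * X))%E](eq_bigr (fun=> (2^-1)%:E)); last by move=> x _; exact: pr_dir.
rewrite !prod_half -EFinM (prE P (measurable_initial_event iB)) -EFinM.
by move=> /(congr1 fine) /=; rewrite -invfM -exprMn -natrM.
Qed.

Local Notation hit p := (hit_event (slow p) (dir p)).

Let coins_of (p : particle) k : seq (particle * nat) := [seq (p, i) | i <- iota 0 k].

Lemma coins_ofE p k (v : nat -> bool * bool) (u : particle * nat -> bool * bool) :
  (forall i, u (p, i) = v i) -> [set w | forall x, x \in coins_of p k -> coin x.1 x.2 w = u x] =
  cylinder (slow p) (dir p) 0 k v.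
Proof.
move=> uv; apply/seteqP; split => w /= all.
  by move=> i ik; rewrite -uv; apply: (all (p, i)); apply: map_f; rewrite mem_iota.
move=> _ /mapP[i + ->]; rewrite mem_iota add0n leq0n/= => ik.
by rewrite uv; exact: all.
Qed.

Lemma uniq_coins_of p k : uniq (coins_of p k).
Proof. by rewrite map_inj_uniq ?iota_uniq// => i j []. Qed.

Lemma fair_initial p B : initial_event B -> fair_future P (slow p) (dir p) 0 B.
Proof.
move=> iB; split; first exact: measurable_initial_event.
move=> k v; rewrite -(@coins_ofE p k v (fun x => v x.2))// pr_coins//.
  by rewrite size_map size_iota.
exact: uniq_coins_of.
Qed.

(** The coins of [p] and of [q] are jointly independent of [B]: fix finitely
    many coins of [p], then compute the hitting probability of [q]. *)
Lemma fair_initial_hit p q B n g r : p != q -> initial_event B ->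
  fair_future P (slow p) (dir p) 0 (B `&` hit q n 0 g r).
Proof.
move=> pq iB; have mB := measurable_initial_event iB.
have mH : measurable (hit q n 0 g r).
  by apply: measurable_hit_event => i; [exact: measurable_slow|exact: measurable_dir].
split; first exact: measurableI.
move=> k v; rewrite setIAC (@pr_hit_event _ _ _ P (slow q) (dir q)); first last.
- split.
    by apply: measurableI => //; apply: measurable_cylinder => i; [exact: measurable_slow|exact: measurable_dir].
    move=> l u; pose uv (x : particle * nat) := if x.1 == p then v x.2 else u x.2.
    have uvp i : uv (p, i) = v i by rewrite /uv eqxx.
    have uvq i : uv (q, i) = u i by rewrite /uv/= eq_sym (negbTE pq).
    rewrite -(coins_ofE k uvp) -(coins_ofE l uvq).
    rewrite -setIA (_ : _ `&` [set w | _] =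
      [set w | forall x, x \in coins_of p k ++ coins_of q l -> coin x.1 x.2 w = uv x]).
      rewrite !pr_coins// ?uniq_coins_of//.
        by rewrite size_cat !size_map !size_iota exprD invfM mulrA.
      rewrite cat_uniq !uniq_coins_of /= andbT; apply/hasPn => _ /mapP[i _ ->].
      by apply/mapP => -[j _ [e _]]; move: pq; rewrite e eqxx.
    apply/seteqP; split => w /=.
      by move=> [h1 h2] x; rewrite mem_cat => /orP[/h1|/h2].
    by move=> h; split => x xs; apply: h; rewrite mem_cat xs ?orbT.
- by move=> i; exact: measurable_dir.
- by move=> i; exact: measurable_slow.
have [_ ->] := fair_initial p iB.
rewrite (pr_hit_event (measurable_slow q) (measurable_dir q) _ _ _ (fair_initial q iB)).
by rewrite mulrAC.
Qed.

Lemma pr_initial_hit p B n g r : initial_event B ->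
  pr P (B `&` hit p n 0 g r) = pr P B * hit_weight n g r.
Proof.
move=> iB; apply: pr_hit_event; last exact: fair_initial.
- by move=> i; exact: measurable_slow.
- by move=> i; exact: measurable_dir.
Qed.

Lemma pr_initial_hit2 p q B n g g' r : p != q -> initial_event B ->
  pr P (B `&` hit q n 0 g' r `&` hit p n 0 g r) =
  pr P B * hit_weight n g' r * hit_weight n g r.
Proof.
move=> pq iB; rewrite -(pr_initial_hit q)//; apply: pr_hit_event.
- by move=> i; exact: measurable_slow.
- by move=> i; exact: measurable_dir.
- exact: fair_initial_hit.
Qed.

End walks.

(** * Diffusive scaling of the hitting probabilities *)
Lemma ler_sum_subset (R : numDomainType) (I : eqType) (s s' : seq I) (f : I -> R) :
  uniq s -> {subset s <= s'} -> (forall i, 0 <= f i) ->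
  \sum_(i <- s) f i <= \sum_(i <- s') f i.
Proof.
move=> + + f0; elim: s s' => [|x s IH] s' /=.
  by move=> _ _; rewrite big_nil sumr_ge0.
move=> /andP[xs us] ss'; have xs' : x \in s' by rewrite ss'// mem_head.
rewrite big_cons (big_rem x xs') lerD2l; apply: IH => // y ys.
apply: rem_mem; first by apply: contraNneq xs => <-.
by rewrite ss'// inE ys orbT.
Qed.

Lemma size_initial_le (eta : nat -> nat) (K : nat) (s : seq particle) :
  uniq s -> (forall p, p \in s -> (p.1 < K)%N /\ (p.2 < eta p.1)%N) ->
  (size s <= psum eta K)%N.
Proof.
move=> us sP; pose l := [seq (i, j) | i <- iota 0 K, j <- iota 0 (eta i)].
have -> : psum eta K = size l.
  rewrite size_allpairs_dep sumnE big_map /psum -(big_mkord xpredT) /index_iota subn0.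
  by apply: eq_bigr => i _; rewrite size_iota.
apply: uniq_leq_size => // -[i j] /sP[/= iK jeta].
by apply/allpairsPdep; exists i, j; rewrite !mem_iota.
Qed.

Section scale.
Context {R : realType} (L : nat).
Hypothesis L_gt0 : (0 < L)%N.

Let LR : R := L%:R.
Let LR1 : 1 <= LR. Proof. by rewrite /LR ler1n. Qed.

(** With [x = L / (L + 1)], the mean of [x] and [x^-1] exceeds [1] by
    [1 / (2 L (L + 1))]: over [L ^ 2] steps this accumulates to a bounded
    factor, while [x ^+ L] is bounded away from [1]. *)
Definition decay : R := L%:R / L.+1%:R.

Lemma decayE : decay = LR / (LR + 1).
Proof. by rewrite /decay /LR -natr1. Qed.

Lemma decay_gt0 : 0 < decay.
Proof. by rewrite decayE divr_gt0//; have := LR1; lra. Qed.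

Lemma decay_le1 : decay <= 1.
Proof. by rewrite decayE ler_pdivrMr; have := LR1; lra. Qed.

Lemma one_sub_decay : 1 - decay = (LR + 1)^-1.
Proof. by rewrite decayE; field; have := LR1; lra. Qed.

(** The bound [hit_weight_le] with [y^-1 = 1 - 1 / (L (L + 1))], which is what
    [x] requires. As the budget is [L ^ 2], the factor in [y] is bounded. *)
Lemma hit_weight_decay n g : hit_weight n g (L * L) <= expR 2 * decay ^+ g.
Proof.
have L1 := LR1.
pose q : R := LR * (LR + 1) - 1.
have q1 : 1 <= q by rewrite /q; nra.
pose y : R := 1 + q^-1.
have yE : y = LR * (LR + 1) / q by rewrite /y /q; field; rewrite -/q; lra.
have y1 : 1 <= y by rewrite /y lerDl invr_ge0; lra.
apply: (le_trans (@hit_weight_le _ decay y n g (L * L) decay_gt0 y1 _)).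
  rewrite yE decayE -subr_ge0.
  rewrite [leRHS](_ : _ = (q * (LR + 1) ^+ 2)^-1).
    by rewrite invr_ge0 mulr_ge0// ?sqr_ge0//; lra.
  rewrite /q; field; rewrite -/q; apply/andP; split; lra.
rewrite mulrC ler_wpM2r ?exprn_ge0 ?(ltW decay_gt0)//.
apply: (@le_trans _ _ (expR q^-1 ^+ (L * L).+1)).
  by rewrite lerXn2r ?nnegrE ?expR_ge0 ?expR_ge1Dx//; lra.
rewrite -expRM_natl ler_expR ler_pdivrMr; last by lra.
by rewrite -natr1 natrM -/LR /q; nra.
Qed.

(** This is the Bernoulli inequality [(1 + 1 / L) ^ L >= 2]. *)
Lemma decay_half : decay ^+ L <= 2^-1.
Proof.
have L1 := LR1.
have bernoulli n : 1 + n%:R * LR^-1 <= (1 + LR^-1) ^+ n.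
  have h0 : 0 <= LR^-1 by rewrite invr_ge0; lra.
  elim: n => [|n IH]; first by rewrite mul0r addr0 expr0.
  rewrite exprS -natr1; apply: (@le_trans _ _ ((1 + LR^-1) * (1 + n%:R * LR^-1))).
    have : 0 <= n%:R :> R by []. nra.
  by rewrite ler_wpM2l//; lra.
have := bernoulli L; rewrite -/LR mulfV; last by lra.
rewrite (_ : 1 + LR^-1 = decay^-1); last by rewrite decayE; field; lra.
rewrite exprVn => le2; rewrite -[leLHS]invrK lef_pV2 ?posrE ?invr_gt0 ?exprn_gt0 ?decay_gt0//.
Qed.

Lemma decay_pow Y : decay ^+ (Y * L) <= (2^-1) ^+ Y.
Proof.
rewrite mulnC exprM; apply: lerXn2r; rewrite ?nnegrE ?exprn_ge0 ?(ltW decay_gt0)//.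
exact: decay_half.
Qed.

(** A summation by parts: it replaces [psum eta i] by its upper bound [i + M],
    for which the sum is explicit. It takes the form of a potential [pot]
    whose discounted value decreases by at least the current term. *)
Lemma discounted_sum (eta : nat -> nat) (M K T : nat) :
  (forall i, (psum eta i <= i + M)%N) ->
  \sum_(K <= i < T) (eta i)%:R * decay ^+ i <= decay ^+ K * (K + M + L.+1)%:R.
Proof.
move=> bound; have L1 := LR1.
have [TK|KT] := leqP T K.
  by rewrite big_geq// mulr_ge0// exprn_ge0// ltW// decay_gt0.
pose pot i : R := (i + M + L.+1)%:R - (psum eta i)%:R.
suff : \sum_(K <= i < T) (eta i)%:R * decay ^+ i + decay ^+ T * pot T <= decay ^+ K * pot K.
  have : decay ^+ K * pot K <= decay ^+ K * (K + M + L.+1)%:R.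
    by rewrite ler_wpM2l ?exprn_ge0 ?(ltW decay_gt0)// /pot gerBl.
  have : 0 <= decay ^+ T * pot T.
    rewrite mulr_ge0 ?exprn_ge0 ?(ltW decay_gt0)// /pot subr_ge0 ler_nat.
    by rewrite (leq_trans (bound T))// leq_addr.
  lra.
move: KT => /ltnW/subnK <-; elim: (T - K)%N => [|n IH].
  by rewrite add0n big_geq// add0r.
apply: le_trans IH; rewrite addSn big_nat_recr ?leq_addl//= -addrA lerD2l.
move: (n + K)%N => i.
rewrite (_ : _ + _ = decay ^+ i * ((eta i)%:R + decay * pot i.+1)); last by rewrite exprS; ring.
rewrite ler_wpM2l ?exprn_ge0 ?(ltW decay_gt0)//.
have := bound i.+1; rewrite -(ler_nat R) /pot.
rewrite (_ : psum eta i.+1 = psum eta i + eta i)%N; last by rewrite /psum big_ord_recr.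
rewrite !natrD -!natr1 -/LR; have := one_sub_decay.
set a := (eta i)%:R; set b := (psum eta i)%:R; set M' := M%:R; set I' := i%:R.
move=> dE step; have -> : decay = 1 - (LR + 1)^-1 by lra.
have inv0 : 0 <= (LR + 1)^-1 by rewrite invr_ge0; lra.
rewrite -subr_ge0.
rewrite [leRHS](_ : _ = (LR + 1)^-1 * (I' + 1 + M' - (b + a))).
  by rewrite mulr_ge0//; lra.
by field; lra.
Qed.

End scale.

(** * Visitors from far away *)
Section far_visitors.
Context {R : realType} {d : measure_display} {Omega : measurableType d}
  (P : probability Omega R) (D mu : R)
  (N : nat -> {mfun Omega >-> nat})
  (hold : particle -> nat -> {RV P >-> R})
  (dir : particle -> nat -> {RV P >-> bool}).
Hypotheses (D_gt0 : 0 < D) (walks : dla_walks D N hold dir).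
Hypotheses (N_mean : forall i : nat, ('E_P[fun w => (N i w)%:R] = mu%:E)%E)
  (mu_le1 : mu <= 1).
Variables (m Y : nat).
Hypothesis Y_gt0 : (0 < Y)%N.

(** At the scale [L], the front is watched at [front_site L] until a time of
    order [L ^ 2], and the particles starting beyond [far_site L] are far.
    These sites are in the ratio [m / (m + 1)], to be taken close to one, and
    at the distance [Y * L], with [Y] to be taken large. *)
Definition front_site (L : nat) : nat := (m * Y * L)%N.
Definition far_site (L : nat) : nat := (front_site L + Y * L)%N.

(** The far particles, truncated to a finite list; the limit in [T] is taken
    at the level of events. *)
Definition far (L T : nat) : seq particle :=
  [seq (i, j) | i <- index_iota (far_site L) T, j <- iota 0 T].

Lemma uniq_far L T : uniq (far L T).
Proof.
apply: allpairs_uniq; [exact: iota_uniq|exact: iota_uniq|].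
by move=> [a1 a2] [b1 b2] _ _ [-> ->].
Qed.

Lemma mem_far L T p : (p \in far L T) = (far_site L <= p.1 < T)%N && (p.2 < T)%N.
Proof.
case: p => i j; apply/allpairsP/andP => /= [[[i' j'] [/= + + [-> ->]]]|[iT jT]].
  by rewrite mem_index_iota mem_iota.
by exists (i, j); rewrite mem_index_iota mem_iota.
Qed.

Definition alive (p : particle) : set Omega := [set w | (p.2 < N p.1 w)%N].

Definition gap (L : nat) (p : particle) : nat := (p.1.+1 - front_site L)%N.

Definition reaches (L T : nat) (p : particle) : set Omega :=
  hit_event (slow D hold p) (dir p) T 0 (gap L p) (L * L).

Definition reach_weight (L T : nat) (p : particle) : R :=
  hit_weight T (gap L p) (L * L).

Lemma initial_event_count i (A : set nat) : initial_event N hold dir (N i @^-1` A).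
Proof.
exists [set x | A (x i)]; last by rewrite setTI.
by have := @measurable_coordinate i measurableT A I; rewrite setTI.
Qed.

Lemma initial_event_setI A B : initial_event N hold dir A -> initial_event N hold dir B ->
  initial_event N hold dir (A `&` B).
Proof.
move=> [A' mA <-] [B' mB <-]; exists (A' `&` B'); last by rewrite preimage_setI setIACA setIid.
by apply: (@measurableI _ seqT).
Qed.

Lemma initial_event_alive p : initial_event N hold dir (alive p).
Proof. exact: (initial_event_count p.1 [set n | (p.2 < n)%N]). Qed.

Lemma measurable_alive p : measurable (alive p).
Proof.
rewrite (_ : alive p = N p.1 @^-1` [set n | (p.2 < n)%N])//.
by rewrite -[X in measurable X]setTI; exact: measurable_funP.
Qed.

Lemma measurable_reaches L T p : measurable (reaches L T p).
Proof.
by apply: measurable_hit_event => i; [exact: measurable_slow|exact: measurable_dir].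
Qed.

Lemma sum_alive_le i T w :
  \sum_(j <- iota 0 T) \1_(alive (i, j)) w <= (N i w)%:R :> R.
Proof.
have -> : \sum_(j <- iota 0 T) (\1_(alive (i, j)) w : R) =
    (\sum_(j <- iota 0 T) (j < N i w))%:R.
  rewrite natr_sum; apply: eq_bigr => j _; rewrite indicE; congr (_%:R).
  by congr nat_of_bool; apply/idP/idP; rewrite inE.
rewrite ler_nat -big_mkcond sum1_count -size_filter -[leqRHS](size_iota 0).
apply: uniq_leq_size; first by rewrite filter_uniq// iota_uniq.
by move=> j; rewrite mem_filter !mem_iota => /andP[].
Qed.
Lemma sum_pr_alive i T : \sum_(j <- iota 0 T) pr P (alive (i, j)) <= mu.
Proof.
have int1 j : (\int[P]_w (\1_(alive (i, j)) w : R)%:E = (pr P (alive (i, j)))%:E)%E.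
  have mA := measurable_alive (i, j).
  by rewrite integral_indic// setIT; exact: (prE P mA).
rewrite -lee_fin -(N_mean i) expectation.unlock -sumEFin.
under eq_bigr do rewrite -int1.
rewrite -ge0_integral_sum//; last first.
  by move=> j; apply/measurable_EFinP/measurable_indic; exact: measurable_alive.
apply: ge0_le_integral => //.
- by move=> w _; apply: sume_ge0 => j _; rewrite lee_fin.
- by apply: emeasurable_sum => j; apply/measurable_EFinP/measurable_indic; exact: measurable_alive.
- by apply/measurable_EFinP; apply: measurableT_comp.
by move=> w _; rewrite sumEFin lee_fin; exact: sum_alive_le.
Qed.

Lemma sum_far L T (f : particle -> R) :
  \sum_(p <- far L T) f p = \sum_(far_site L <= i < T) \sum_(j <- iota 0 T) f (i, j).
Proof. by rewrite /far big_allpairs. Qed.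

(** There are at most [mu] particles per site on average. *)
Lemma expected_reaches L T : (0 < L)%N ->
  \sum_(p <- far L T) pr P (alive p) * reach_weight L T p <= expR 2 * (2 * L%:R).
Proof.
move=> L0; rewrite sum_far.
apply: (@le_trans _ _ (\sum_(far_site L <= i < T) expR 2 * decay L ^+ (i - far_site L))).
  apply: ler_sum_nat => i /andP[Ki iT].
  apply: (@le_trans _ _ (\sum_(j <- iota 0 T) pr P (alive (i, j)) * (expR 2 * decay L ^+ (i - far_site L)))).
    apply: ler_sum => j _; rewrite ler_wpM2l ?pr_ge0//.
    apply: (le_trans (hit_weight_decay L0 _ _)); rewrite ler_wpM2l ?expR_ge0//.
    apply: ler_wiXn2l; rewrite ?(ltW (decay_gt0 L0)) ?decay_le1//.
    by rewrite /gap /far_site /=; move: (front_site L) (Y * L)%N => u v; lia.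
  rewrite -mulr_suml ler_piMl ?mulr_ge0 ?expR_ge0 ?exprn_ge0 ?(ltW (decay_gt0 L0))//.
  exact: le_trans (sum_pr_alive i T) mu_le1.
rewrite -mulr_sumr ler_wpM2l ?expR_ge0//.
rewrite -{1}[far_site L]add0n big_addn.
under eq_bigr do rewrite addnK.
move: (T - far_site L)%N => n; rewrite big_mkord.
have e1 : 1 - decay L = (L%:R + 1)^-1 :> R := one_sub_decay L0.
have L1 : 1 <= L%:R :> R by rewrite ler1n.
have : (1 - decay L) * (\sum_(i < n) decay L ^+ i) <= 1 :> R.
  by rewrite -opprB mulNr -subrX1 opprB lerBlDr lerDl exprn_ge0// ltW// decay_gt0.
rewrite e1 mulrC ler_pdivrMr; last by lra.
lra.
Qed.

(** The second moment is of order [L] and the deviation of order [L]. *)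
Lemma pr_deviation L T : (0 < L)%N ->
  pr P [set w | (Y * L)%:R / 2 <= \sum_(p <- far L T)
    \1_(alive p) w * (\1_(reaches L T p) w - reach_weight L T p)] <= 8 * expR 2 / L%:R.
Proof.
move=> L0; have YL0 : 0 < (Y * L)%:R / 2 :> R by rewrite divr_gt0// ltr0n muln_gt0 Y_gt0.
apply: (@le_trans _ _ ((\sum_(p <- far L T) pr P (alive p) * reach_weight L T p)
                         / ((Y * L)%:R / 2) ^+ 2)).
  apply: chebyshev_sum => //.
  - exact: measurable_alive.
  - exact: measurable_reaches.
  - by move=> p; exact: hit_weight_ge0.
  - exact: uniq_far.
  - by move=> p; apply: (pr_initial_hit D_gt0 walks); exact: initial_event_alive.
  - move=> p q pq; have iI := initial_event_setI (initial_event_alive p) (initial_event_alive q).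
    split; first exact: (pr_initial_hit D_gt0 walks).
    exact: (pr_initial_hit2 D_gt0 walks).
rewrite ler_pdivrMr ?exprn_gt0//; apply: (le_trans (expected_reaches T L0)).
have L1 : 1 <= L%:R :> R by rewrite ler1n.
have Y1 : 1 <= Y%:R :> R by rewrite ler1n.
rewrite natrM (_ : _ * _ ^+ 2 = expR 2 * (2 * L%:R) * Y%:R ^+ 2); last by field; lra.
by rewrite ler_peMr ?exprn_ege1// !mulr_ge0// expR_ge0.
Qed.

Definition many (L T : nat) : set Omega := [set w | (Y * L)%:R * (3 / 4) <=
  \sum_(p <- far L T) \1_(alive p) w * \1_(reaches L T p) w :> R].

(** The sum is the conditional mean, given the initial configuration, of the
    sum that appears in [many]. *)
Definition mild (L T : nat) : set Omega := [set w |
  \sum_(p <- far L T) \1_(alive p) w * reach_weight L T p <= (Y * L)%:R / 4].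

(** The second event does not depend on [T] and the first increases with [T],
    so the probability of the union is a limit. *)
Definition crowded (L : nat) : set Omega :=
  \bigcup_T (many L T `&` \bigcap_T' mild L T').

Let measurable_far_sum L T (f : particle -> Omega -> R) :
  (forall p, measurable_fun setT (f p)) ->
  measurable_fun setT (fun w => \sum_(p <- far L T) \1_(alive p) w * f p w).
Proof.
move=> mf; apply: measurable_sum => p; apply: measurable_funM => //.
by apply: measurable_indic; exact: measurable_alive.
Qed.

Lemma measurable_many L T : measurable (many L T).
Proof.
apply: measurable_ler; first exact: measurable_cst.
by apply: measurable_far_sum => p; apply: measurable_indic; exact: measurable_reaches.
Qed.

Lemma measurable_mild L T : measurable (mild L T).
Proof.
apply: measurable_ler; last exact: measurable_cst.
by apply: measurable_far_sum => p; exact: measurable_cst.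
Qed.

Lemma measurable_crowded L : measurable (crowded L).
Proof.
apply: bigcup_measurable => T _; apply: measurableI; first exact: measurable_many.
by apply: bigcapT_measurable => T'; exact: measurable_mild.
Qed.

Lemma many_leS L T : many L T `<=` many L T.+1.
Proof.
move=> w /= /le_trans; apply.
apply: (@le_trans _ _ (\sum_(p <- far L T) \1_(alive p) w * \1_(reaches L T.+1 p) w)).
  apply: ler_sum => p _; rewrite ler_wpM2l// !indicE ler_nat.
  case: (boolP (w \in reaches L T p)) => //; rewrite !inE => h.
  by rewrite mem_set//; exact: hits_leS.
apply: ler_sum_subset.
- exact: uniq_far.
- move=> p; rewrite !mem_far => /andP[/andP[-> /= iT] jT].
  by rewrite /= !ltnS (ltnW iT) (ltnW jT).
- by move=> p; rewrite mulr_ge0.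
Qed.

Lemma P_crowded L : (0 < L)%N -> (P (crowded L) <= (8 * expR 2 / L%:R)%:E)%E.
Proof.
move=> L0; pose E T := many L T `&` \bigcap_T' mild L T'.
have mE T : measurable (E T).
  apply: measurableI; first exact: measurable_many.
  by apply: bigcapT_measurable => T'; exact: measurable_mild.
have cvgE : P (E T) @[T --> \oo] --> P (crowded L)%E.
  apply: nondecreasing_cvg_mu => //; first exact: measurable_crowded.
  by apply/nondecreasing_seqP => T; apply/subsetPset; apply: setSI; exact: many_leS.
rewrite -(cvg_lim _ cvgE)//; apply: lime_le; first by apply/cvg_ex; eexists; exact: cvgE.
apply: nearW => T; rewrite prE// lee_fin; apply: le_trans (pr_deviation T L0).
apply: le_pr => //.
  apply: measurable_ler; first exact: measurable_cst.
  apply: measurable_far_sum => p; apply: measurable_funB; last exact: measurable_cst.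
  by apply: measurable_indic; exact: measurable_reaches.
move=> w [/= many_w mild_w]; have {mild_w} /= mild_w := mild_w T I.
under eq_bigr do rewrite mulrBr; rewrite big_split/= sumrN.
by move: many_w mild_w; rewrite /many /mild /=; lra.
Qed.

(** The Borel-Cantelli lemma. *)
Lemma ae_eventually_not_crowded :
  {ae P, forall w, exists n0, forall n, (n0 <= n)%N -> ~ crowded (2 ^ n)%N w}.
Proof.
exists (lim_sup_set (fun n => crowded (2 ^ n)%N)); split.
- apply: bigcapT_measurable => n; apply: bigcup_measurable => j _; exact: measurable_crowded.
- apply: lim_sup_set_cvg0 => [n|]; first exact: measurable_crowded.
  apply: (@le_lt_trans _ _ (\sum_(0 <= n <oo) (16 * expR 2 / (2 ^ n.+1)%:R)%:E)%E); last first.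
    apply: (@le_lt_trans _ _ (16 * expR 2)%:E); last by rewrite ltry.
    by apply: epsilon_trick0; rewrite mulr_ge0// expR_ge0.
  apply: lee_nneseries => // n _.
  apply: (le_trans (P_crowded _)); first by rewrite expn_gt0.
  rewrite lee_fin expnS natrM; have : (0 : R) < (2 ^ n)%:R by rewrite ltr0n expn_gt0.
  move=> ?; rewrite le_eqVlt; apply/orP; left; apply/eqP; field; lra.
- move=> w /= no n _; apply: contrapT => nc; apply: no; exists n => j nj cj.
  by apply: nc; exists j.
Qed.

End far_visitors.

(** * Almost sure regularity of the walks *)
Section regularity.
Context {R : realType} {d : measure_display} {Omega : measurableType d}
  (P : probability Omega R) (D : R)
  (N : nat -> {mfun Omega >-> nat})
  (hold : particle -> nat -> {RV P >-> R})
  (dir : particle -> nat -> {RV P >-> bool}).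
Hypotheses (D_gt0 : 0 < D) (walks : dla_walks D N hold dir).

Local Notation jumps p w := (jump_time (fun i => hold p i w)).

Lemma ae_forall_particle (Q : particle -> Omega -> Prop) :
  (forall p, {ae P, forall w, Q p w}) -> {ae P, forall w, forall p, Q p w}.
Proof.
move=> aeQ.
have : {ae P, forall w, forall i j, Q (i, j) w}.
  by apply: ae_foralln => i; apply: ae_foralln => j; exact: aeQ.
by apply: filterS => w allw [i j].
Qed.

Lemma ae_hold_gt0 : {ae P, forall w, forall p i, 0 < hold p i w}.
Proof.
apply: ae_forall_particle => p; apply: ae_foralln => i.
exists (hold p i @^-1` `]-oo, 0%R]); split.
- by rewrite -[X in measurable X]setTI; exact: measurable_funP.
- by apply: etrans (P_hold walks p i _) _ => //; exact: exponential_prob_le0.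
- by move=> w /= /negP; rewrite in_itv/= -leNgt.
Qed.

Lemma pr_never_slow p m k :
  P [set w | forall i, (i < k)%N -> slow D hold p (m + i)%N w = false] = ((2 ^+ k)^-1)%:E.
Proof.
have [indep _ _] := walks.
pose I : eqType := option ((particle * nat) + (particle * nat))%type.
pose ix i : I := Some (inl (p, (m + i)%N)).
pose l : seq I := [seq ix i | i <- iota 0 k].
pose A (i : I) : set Omega := match i with
  | Some (inl x) => [set w | slow D hold x.1 x.2 w = false]
  | _ => setT end.
have ul : uniq l by rewrite map_inj_uniq ?iota_uniq// => i j [/addnI].
have Al i : i \in l -> dla_sigma N hold dir i (A i).
  move=> /mapP[j _ ->] /=; exists [set r | (median D < r) = false]; last by rewrite setTI.
  by apply: measurable_boolval; apply: measurable_fun_ltr => //; exact: measurable_cst.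
have := indep l A ul Al.
rewrite big_map (eq_bigr (fun=> (2^-1)%:E)); last by move=> i _; exact: (pr_slow D_gt0 walks).
rewrite prod_half size_iota => <-; congr (P _); apply/seteqP; split => w /=.
  by move=> all _ /mapP[i + ->]; rewrite mem_iota => ik; exact: all.
by move=> all i ik; apply: (all (ix i)); apply: map_f; rewrite mem_iota.
Qed.

Lemma ae_slow_infinitely_often :
  {ae P, forall w, forall p m, exists2 i, (m <= i)%N & slow D hold p i w}.
Proof.
apply: ae_forall_particle => p; apply: ae_foralln => m.
pose E := \bigcap_k [set w | forall i, (i < k)%N -> slow D hold p (m + i)%N w = false].
have mE k : measurable [set w | forall i, (i < k)%N -> slow D hold p (m + i)%N w = false].
  rewrite (_ : [set w | _] = \bigcap_(i in [set i | (i < k)%N])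
      [set w | slow D hold p (m + i)%N w = false]); last first.
    by apply/seteqP; split => w /= all i ik; exact: all.
  by apply: bigcap_measurableType => i _; apply: measurable_boolval; exact: measurable_slow.
have mEE : measurable E by apply: bigcapT_measurable.
exists E; split => //.
- apply/le_anti/andP; split => //; apply/lee_addgt0Pr => e e0; rewrite add0e.
  have [k ke] : exists k, (2 ^+ k)^-1 <= e.
    exists (Num.bound e^-1); rewrite -[leRHS]invrK lef_pV2 ?posrE ?exprn_gt0 ?invr_gt0//.
    rewrite ltW// (lt_trans (archi_boundP _)) ?invr_ge0 ?ltW//.
    by have := ltn_expl (Num.bound e^-1) (isT : (1 < 2)%N); rewrite -(ltr_nat R) natrX.
  apply: (@le_trans _ _ (((2 ^+ k)^-1)%:E)); last by rewrite lee_fin.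
  rewrite -(pr_never_slow p m k); apply: le_measure; rewrite ?inE//.
  by move=> w; apply.
- move=> w /= none k _ i ik; apply/negbTE/negP => sl; apply: none.
  by exists (m + i)%N => //; rewrite leq_addr.
Qed.

Lemma jump_time_unbounded_of_slow w p :
  (forall i, 0 < hold p i w) ->
  (forall m, exists2 i, (m <= i)%N & slow D hold p i w) ->
  forall t, exists n, t < jumps p w n.
Proof.
move=> hold_gt0 often t; have a0 := median_gt0 D_gt0.
have incr m n : (m <= n)%N -> jumps p w m <= jumps p w n.
  by move=> mn; rewrite jump_time_mono.
have reach k : exists n, k%:R * median D <= jumps p w n.
  elim: k => [|k [n IH]]; first by exists 0%N; rewrite mul0r jump_time0.
  have [i ni sl] := often n; exists i.+1.
  rewrite jump_timeS -natr1 mulrDl mul1r; apply: lerD; last exact: ltW.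
  exact: le_trans IH (incr _ _ ni).
have [n tn] := reach (Num.bound (`|t| / median D)).
exists n; apply: lt_le_trans tn; rewrite -ltr_pdivrMr//.
apply: le_lt_trans (archi_boundP _); last by rewrite divr_ge0// ltW.
apply: ler_wpM2r; last exact: ler_norm.
by rewrite invr_ge0 ltW.
Qed.

Section ties.
Variables (p q : particle) (n m : nat).
Hypothesis pq : p != q.

(** A family stable under intersections that generates the sigma-algebra of
    all the holding times except the first one of [p]. *)
Definition other_holds : set (set Omega) := [set A | exists (s : seq (particle * nat))
  (F : particle * nat -> set R), [/\ uniq s, (p, 0%N) \notin s,
    (forall x, measurable (F x)) &
    A = [set w | forall x, x \in s -> F x (hold x.1 x.2 w)]]].

Lemma other_holds_setI : setI_closed other_holds.
Proof.
move=> _ _ [s [F [us ps mF ->]]] [s' [F' [us' ps' mF' ->]]].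
exists (undup (s ++ s')), (fun x => (if x \in s then F x else setT) `&`
                                    (if x \in s' then F' x else setT)).
split.
- exact: undup_uniq.
- by rewrite mem_undup mem_cat negb_or ps.
- by move=> x; apply: measurableI; case: ifP.
- apply/seteqP; split => w /=.
    by move=> [h1 h2] x _; split; case: ifP => //; [exact: h1|exact: h2].
  move=> h; split => x xs; have := h x; rewrite mem_undup mem_cat xs ?orbT => /(_ isT)[].
    by [].
  by [].
Qed.

Lemma other_holds_indep A (B : set R) : measurable B -> other_holds A ->
  P (A `&` hold p 0%N @^-1` B) = (P A * P (hold p 0%N @^-1` B))%E.
Proof.
move=> mB [s [F [us ps mF ->]]]; have [indep _ _] := walks.
pose I : eqType := option ((particle * nat) + (particle * nat))%type.
pose ix x : I := Some (inl x).
pose E (i : I) : set Omega := match i with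
  | Some (inl x) => hold x.1 x.2 @^-1` (if x == (p, 0%N) then B else F x)
  | _ => setT end.
have ixI : injective ix by move=> x y [].
have us' : uniq [seq ix x | x <- s] by rewrite map_inj_uniq.
have mEx i : i \in [seq ix x | x <- (p, 0%N) :: s] -> dla_sigma N hold dir i (E i).
  move=> /mapP[[p' j] _ ->] /=.
  by exists (if (p', j) == (p, 0%N) then B else F (p', j)); [case: ifP|rewrite setTI].
have us0 : uniq [seq ix x | x <- (p, 0%N) :: s] by rewrite map_inj_uniq//= ps.
have e1 : P (\bigcap_(i in [set` [seq ix x | x <- s]]) E i) =
    (\prod_(i <- [seq ix x | x <- s]) P (E i))%E.
  by apply: indep => // i il; apply: mEx; rewrite inE il orbT.
have e2 := indep _ E us0 mEx.
rewrite big_cons -e1 in e2.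
have -> : [set w | forall x, x \in s -> F x (hold x.1 x.2 w)] =
    \bigcap_(i in [set` [seq ix x | x <- s]]) E i.
  apply/seteqP; split => w /= all.
    move=> _ /mapP[x xs ->] /=; case: eqP => [xp|_]; last exact: all.
    by move: ps; rewrite -xp xs.
  move=> x xs; have := all (ix x); rewrite /= map_f// => /(_ isT).
  by case: eqP => // xp; move: ps; rewrite -xp xs.
rewrite muleC; have -> : hold p 0%N @^-1` B = E (ix (p, 0%N)) by rewrite /= eqxx.
rewrite -e2; congr (P _); apply/seteqP; split => w /=.
  by move=> [all Ep] i; rewrite /= inE => /orP[/eqP ->|/all].
move=> all; split; last by apply: (all (ix (p, 0%N))); rewrite /= inE eqxx.
by move=> i il; apply: all; rewrite /= inE il orbT.
Qed.

(** Two finite measures that agree on a family stable under intersections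
    agree on the sigma-algebra that it generates. *)
Lemma sigma_other_holds_indep A (B : set R) : measurable B -> <<s other_holds >> A ->
  P (A `&` hold p 0%N @^-1` B) = (P A * P (hold p 0%N @^-1` B))%E.
Proof.
move=> mB sA.
have mE : measurable (hold p 0%N @^-1` B) by rewrite -[X in measurable X]setTI; exact: measurable_funP.
have sub : other_holds `<=` measurable.
  move=> _ [s [F [us ps mF ->]]].
  rewrite (_ : [set w | _] = \bigcap_(x in [set` s]) (hold x.1 x.2 @^-1` F x))//.
  apply: fin_bigcap_measurable => [|x _]; first exact: finite_seq.
  rewrite -[X in measurable X]setTI.
  exact: measurable_funP.
have c0 : (0 <= pr P (hold p 0%N @^-1` B))%R := pr_ge0 _ _.
have m1E A' : mrestr P mE A' = P (A' `&` hold p 0%N @^-1` B) by [].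
have m2E A' : mscale (NngNum c0) P A' = (P A' * P (hold p 0%N @^-1` B))%E.
  by rewrite muleC (prE P mE).
rewrite -m1E -m2E.
apply: (@g_sigma_algebra_measure_unique _ R Omega other_holds sub (fun=> setT)) => //.
- move=> _; exists [::], (fun=> setT); split => //.
  by apply/seteqP; split.
- by rewrite bigcup_const.
- exact: other_holds_setI.
- by move=> A' oA'; apply: etrans (m1E A') (etrans _ (esym (m2E A'))); exact: other_holds_indep.
- move=> _; apply: (@le_lt_trans _ _ 1%E); last exact: ltry.
  by apply: probability_le1; exact: measurableI.
Qed.

(** A tie prescribes the first holding time of [p] as a function [Z] of the
    other holding times, which are independent of it. Cut the half-line into
    cells that this holding time visits with probability at most [e] each: it
    lies in the same cell as [Z] with probability at most [e]. *)
Lemma ae_no_tie_pair : {ae P, forall w, jumps p w n.+1 != jumps q w m.+1}.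
Proof.
pose Z w := \sum_(i < m.+1) hold q i w - \sum_(i < n) hold p i.+1 w.
pose OT := g_sigma_algebraType other_holds.
have mother x : x != (p, 0%N) -> measurable_fun setT (hold x.1 x.2 : OT -> R).
  move=> xp _ B mB; apply: sub_sigma_algebra; rewrite setTI.
  exists [:: x], (fun=> B); split => //; first by rewrite inE eq_sym.
  apply/seteqP; split => w /=; first by move=> h y; rewrite inE => /eqP ->.
  by apply; rewrite inE.
have mZ : measurable_fun setT (Z : OT -> R).
  apply: measurable_funB; apply: measurable_sum => i.
    by apply: (mother (q, i : nat)); apply: contraNneq pq => -[-> _].
  by apply: (mother (p, i.+1)); apply/eqP => -[].
have mZ' : measurable_fun setT (Z : Omega -> R).
  apply: measurable_funB; apply: measurable_sum => i; exact: measurable_hold.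
pose tie := [set w | hold p 0%N w = Z w].
have mtie : measurable tie.
  rewrite (_ : tie = [set w | hold p 0%N w <= Z w] `&` [set w | Z w <= hold p 0%N w]).
    by apply: measurableI; apply: measurable_ler.
  by apply/seteqP; split => w /=; [move=> ->; rewrite lexx|case=> h1 h2; apply/le_anti/andP].
exists tie; split => //; last first.
  move=> w /= /negP; rewrite negbK /jump_time => /eqP e; rewrite /tie /Z /=.
  by rewrite -e big_ord_recl addrK.
apply/le_anti/andP; split => //; apply/lee_addgt0Pr => e e0; rewrite add0e.
(* the density is at most [D], so a cell of this length has probability [e] at most *)
pose de := e / D.
have de0 : 0 < de by rewrite divr_gt0.
pose cell (j : nat) : set R := `[j%:R * de, j.+1%:R * de[%classic.
have mcell j : measurable (cell j) by exact: measurable_itv.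
pose Xneg := hold p 0%N @^-1` `]-oo, 0%R].
have mXneg : measurable Xneg by rewrite -[X in measurable X]setTI; exact: measurable_funP.
have mZc j : measurable (Z @^-1` cell j) by rewrite -[X in measurable X]setTI; exact: mZ'.
have mXc j : measurable (hold p 0%N @^-1` cell j) by rewrite -[X in measurable X]setTI; exact: measurable_funP.
pose both j := Z @^-1` cell j `&` hold p 0%N @^-1` cell j.
have cover : tie `<=` Xneg `|` \bigcup_j both j.
  move=> w tw; have [X0|X0] := leP (hold p 0%N w) 0; first by left; rewrite /Xneg /= in_itv.
  right; exists (Num.truncn (hold p 0%N w / de)) => //.
  have cw : cell (Num.truncn (hold p 0%N w / de)) (hold p 0%N w).
    rewrite /cell /= in_itv /= -ler_pdivlMr// -ltr_pdivrMr//.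
    by apply: truncn_itv; rewrite divr_ge0// ltW.
  by split => //=; rewrite -tw.
have mboth j : measurable (both j) by exact: measurableI.
have mU : measurable (\bigcup_j both j) by apply: bigcup_measurable.
apply: (@le_trans _ _ (P Xneg + P (\bigcup_j both j))%E).
  apply: (@le_trans _ _ (P (Xneg `|` \bigcup_j both j))); last exact: measureU2.
  by apply: le_measure; rewrite ?inE//; exact: measurableU.
rewrite (P_hold walks)// exponential_prob_le0// add0e.
apply: (@le_trans _ _ (\sum_(0 <= j <oo) P (both j))%E).
  exact: measure_sigma_subadditive.
apply: (@le_trans _ _ (\sum_(0 <= j <oo) (e%:E * P (Z @^-1` cell j)))%E).
  apply: lee_nneseries => // j _; rewrite /both sigma_other_holds_indep//; last first.
    by rewrite -[X in <<s _ >> X]setTI; exact: mZ.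
  rewrite muleC lee_wpmul2r// (P_hold walks)//.
  apply: le_trans (exponential_prob_le D_gt0 (mcell j)) _.
  rewrite lebesgue_measure_itv /= lte_fin ltr_pM2r// ltr_nat ltnSn.
  by rewrite -EFinB -EFinM lee_fin -mulrBl -natr1 addrAC subrr add0r mul1r mulrC divfK// gt_eqF.
rewrite nneseriesZl//.
have triv : trivIset setT (fun j => Z @^-1` cell j).
  apply/trivIsetP => i j _ _ /eqP ij; apply/seteqP; split => // w [].
  rewrite /cell /= !in_itv/= => /andP[i1 i2] /andP[j1 j2]; apply: ij.
  have := le_lt_trans i1 j2; have := le_lt_trans j1 i2.
  by rewrite !ltr_pM2r// !ltr_nat !ltnS => ji ij; apply/eqP; rewrite eqn_leq ij.
have -> : (\sum_(0 <= j <oo) P (Z @^-1` cell j) = P (\bigcup_j (Z @^-1` cell j)))%E.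
  rewrite [RHS]measure_bigcup//.
  by apply: eq_eseriesl => // i; rewrite in_setT.
rewrite -[leRHS]mule1 lee_pmul2l//; apply: probability_le1; exact: bigcup_measurable.
Qed.

End ties.

Lemma ae_no_tie : {ae P, forall w, forall p q n m, p != q ->
  jumps p w n.+1 != jumps q w m.+1}.
Proof.
apply: ae_forall_particle => p; apply: ae_forall_particle => q.
apply: ae_foralln => n; apply: ae_foralln => m.
case: (eqVneq p q) => [_|pq]; first by apply: aeW.
by apply: filterS (ae_no_tie_pair n m pq).
Qed.

End regularity.

(** * The front grows at most like the square root *)
Section main_bound.
Context {R : realType} {d : measure_display} {Omega : measurableType d}
  (P : probability Omega R) (D mu : R)
  (N : nat -> {mfun Omega >-> nat})
  (hold : particle -> nat -> {RV P >-> R})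
  (dir : particle -> nat -> {RV P >-> bool}).
Hypotheses (D_gt0 : 0 < D) (walks : dla_walks D N hold dir).

Section good_sample.
Variables (m Y : nat) (c : R).
Hypotheses (Y_gt0 : (0 < Y)%N) (c_ge0 : 0 <= c) (c_le1 : c <= 1).
Hypothesis cm : c * m.+1%:R <= m%:R - 1.
Hypothesis large_Y : 4 * expR 2 * (m%:R + 4) <= 2 ^+ Y :> R.

Variables (w : Omega) (M L : nat).
Hypotheses (L_gt0 : (0 < L)%N) (ML : (4 * M <= L)%N).
Hypothesis bounded : forall i, (psum (seq_of N w) i)%:R <= c * i%:R + M%:R :> R.

Local Notation eta := (seq_of N w).

(** The discount over the distance [Y * L] is at most [2 ^- Y], and the
    number of particles at stake is of order [m Y L]. *)
Lemma mild_of_bounded T : mild (R := R) N m Y L T w.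
Proof.
rewrite /mild /= sum_far.
have x0 := decay_gt0 (R := R) L_gt0; have x1 := decay_le1 (R := R) L_gt0.
set x : R := decay L in x0 x1 *.
set K := far_site m Y L; set k := front_site m Y L.
have kK : (k <= K)%N by rewrite /K /far_site leq_addr.
have KE : K = (m.+1 * Y * L)%N by rewrite /K /far_site /front_site; lia.
apply: (@le_trans _ _ (expR 2 / x ^+ k * \sum_(K <= i < T) (eta i)%:R * x ^+ i)).
  rewrite mulr_sumr; apply: ler_sum_nat => i /andP[Ki iT].
  rewrite (_ : expR 2 / x ^+ k * _ = (eta i)%:R * (expR 2 * x ^+ (i - k))); last first.
    rewrite expfB_cond ?gt_eqF//; last by rewrite (leq_trans kK).
    by ring.
  rewrite (eq_bigr (fun j => \1_(alive N (i, j)) w * hit_weight T (i.+1 - k) (L * L)))//.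
  rewrite -mulr_suml; apply: ler_pM => //.
  - by apply: sumr_ge0 => j _.
  - exact: hit_weight_ge0.
  - exact: sum_alive_le.
  - apply: (le_trans (hit_weight_decay L_gt0 _ _)); rewrite ler_wpM2l ?expR_ge0//.
    by apply: ler_wiXn2l; rewrite ?(ltW x0)//; lia.
have bound i : (psum eta i <= i + M)%N.
  rewrite -(ler_nat R) natrD (le_trans (bounded i))// lerD2r.
  by rewrite ler_piMl.
apply: (@le_trans _ _ (expR 2 / x ^+ k * (x ^+ K * (K + M + L.+1)%:R))).
  rewrite ler_wpM2l ?mulr_ge0 ?expR_ge0 ?invr_ge0 ?exprn_ge0 ?(ltW x0)//.
  exact: discounted_sum.
rewrite (_ : expR 2 / x ^+ k * _ = expR 2 * x ^+ (Y * L) * (K + M + L.+1)%:R); last first.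
  rewrite (_ : K = k + Y * L)%N// exprD; field.
  by rewrite expf_neq0// gt_eqF.
have L1 : 1 <= L%:R :> R by rewrite ler1n.
have Y1 : 1 <= Y%:R :> R by rewrite ler1n.
have m0 : 0 <= m%:R :> R by [].
have M4 : M%:R <= L%:R / 4 :> R.
  by move: ML; rewrite -(ler_nat R) natrM; lra.
have size_le : (K + M + L.+1)%:R <= (m%:R + 4) * (Y * L)%:R :> R.
  rewrite KE !natrD -natr1 !natrM -natr1; nra.
have pow_le : expR 2 * x ^+ (Y * L) * (m%:R + 4) <= 4^-1.
  have e0 : 0 < expR 2 :> R by exact: expR_gt0.
  have p0 : 0 < 2 ^+ Y :> R by exact: exprn_gt0.
  apply: (@le_trans _ _ (expR 2 * (2^-1) ^+ Y * (m%:R + 4))).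
    apply: ler_wpM2r; first by rewrite addr_ge0.
    by apply: ler_wpM2l; [exact: ltW|exact: decay_pow].
  rewrite exprVn mulrAC ler_pdivrMr//; have := large_Y; lra.
apply: (@le_trans _ _ (expR 2 * x ^+ (Y * L) * ((m%:R + 4) * (Y * L)%:R))).
  by rewrite ler_wpM2l// mulr_ge0 ?expR_ge0 ?exprn_ge0 ?(ltW x0).
by rewrite mulrA mulrC ler_wpM2l.
Qed.

Hypothesis hold_gt0 : forall p i, 0 < hold p i w.
Hypothesis calm : ~ crowded D N hold dir m Y L w.

Local Notation h := (fun p i => hold p i w).
Local Notation b := (fun p i => dir p i w).

Let time : R := median D * (L * L)%:R.

Lemma reaches_of_visit p : (far_site m Y L <= p.1)%N ->
  visits eta h b (front_site m Y L) time p ->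
  exists n, forall T, (n <= T)%N -> reaches D hold dir m Y L T p w.
Proof.
move=> Kp [_ [n [Tn posn]]]; exists n => T nT.
apply: (@hits_of_path _ _ T 0 _ _ n) => //.
- rewrite -(ler_nat R) -(@ler_pM2l _ (median D)) ?median_gt0//.
  apply: le_trans Tn; rewrite natr_sum mulr_sumr; apply: ler_sum => i _.
  rewrite add0n /slow; case: ltP => [/ltW|_]; first by rewrite mulr1.
  by rewrite mulr0 ltW.
- move: posn; rewrite /walk_pos /start /gap.
  have : (front_site m Y L <= p.1.+1)%N.
    by rewrite ltnW// ltnS (leq_trans _ Kp)// leq_addr.
  under [X in _ -> _ -> _ + X <= _]eq_bigr do rewrite add0n.
  by move: (\sum_(i < n) _) => z; lia.
Qed.

(** Near visitors are at most [c * K + M], which [cm] bounds by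
    [(m - 1) Y L + M], and far visitors are fewer than [3 / 4 Y L]. *)
Lemma few_visitors s : uniq s ->
  (forall p, p \in s -> visits eta h b (front_site m Y L) time p) ->
  (size s < front_site m Y L)%N.
Proof.
move=> us sP; set K := far_site m Y L; set k := front_site m Y L.
pose is_near (p : particle) := (p.1 < K)%N.
have near_le : (size ([seq p <- s | is_near p]) <= psum eta K)%N.
  apply: size_initial_le; first exact: filter_uniq.
  by move=> p; rewrite mem_filter => /andP[pK /sP[]].
pose fs := [seq p <- s | predC is_near p].
have fsP p : p \in fs -> (K <= p.1)%N /\ visits eta h b k time p.
  by rewrite mem_filter /= -leqNgt => /andP[? /sP].
have /choice[n nP] : forall p, exists n, p \in fs ->
    forall T, (n <= T)%N -> reaches D hold dir m Y L T p w.
  move=> p; have [pf|_] := boolP (p \in fs); last by exists 0%N.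
  by have [Kp /(reaches_of_visit Kp)[n nP]] := fsP p pf; exists n.
pose T := (\max_(p <- fs) maxn (maxn p.1.+1 p.2.+1) (n p))%N.
have fsT p : p \in fs -> [/\ (p.1 < T)%N, (p.2 < T)%N & (n p <= T)%N].
  move=> pf; have := leq_bigmax_seq (P := xpredT) (F := fun p => maxn (maxn p.1.+1 p.2.+1) (n p)) p pf isT.
  by rewrite !geq_max => /andP[/andP[? ?] ?].
have far_lt : (size fs)%:R < (Y * L)%:R * (3 / 4) :> R.
  rewrite ltNge; apply/negP => many_fs; apply: calm; exists T => //; split; last first.
    by move=> T' _; exact: mild_of_bounded.
  apply: (le_trans many_fs).
  pose f p : R := \1_(alive N p) w * \1_(reaches D hold dir m Y L T p) w.
  rewrite [leLHS](_ : _ = \sum_(p <- fs) f p); last first.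
    rewrite big_seq (eq_bigr (fun=> 1)); last first.
      move=> p pf; have [Kp [alive_p _]] := fsP p pf.
      rewrite /f !indicE mem_set// mem_set ?mul1r//.
      by apply: nP => //; have [] := fsT p pf.
    by rewrite -big_seq big_const_seq count_predT iter_addr_0.
  apply: ler_sum_subset; first exact: filter_uniq.
    move=> p pf; rewrite mem_far; have [-> -> _] := fsT p pf.
    by rewrite andbT andbT; have [] := fsP p pf.
  by move=> p; rewrite mulr_ge0.
have := count_predC is_near s; rewrite -!size_filter -/fs => sizeE.
rewrite -(ltr_nat R) -sizeE natrD.
have : (size [seq p <- s | is_near p])%:R <= c * K%:R + M%:R.
  by apply: le_trans (bounded K); rewrite ler_nat.
have L1 : 1 <= L%:R :> R by rewrite ler1n.
have Y1 : 1 <= Y%:R :> R by rewrite ler1n.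
have M4 : M%:R <= L%:R / 4 :> R by move: ML; rewrite -(ler_nat R) natrM; lra.
have cK : c * K%:R <= (m%:R - 1) * (Y * L)%:R.
  rewrite (_ : K = m.+1 * (Y * L))%N; last by rewrite /K /far_site /front_site; lia.
  by rewrite natrM mulrA ler_wpM2r.
have M4' : M%:R <= (Y * L)%:R / 4 :> R by rewrite natrM; nra.
rewrite (_ : k = m * (Y * L))%N; last by rewrite /k /front_site mulnA.
rewrite [X in _ -> _ < X]natrM; move: far_lt; lra.
Qed.

End good_sample.

Hypotheses (N_stationary : stationary P N) (N_ergodic : ergodic P N)
  (N_mean : forall i : nat, ('E_P[fun w => (N i w)%:R] = mu%:E)%E)
  (mu_gt0 : 0 < mu) (mu_lt1 : mu < 1).

Lemma dla_front_nd eta (h : particle -> nat -> R) b s t : s <= t ->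
  (dla_front eta h b s <= dla_front eta h b t)%E.
Proof.
move=> st; apply: ereal_sup_le => _ [k /= ks <-]; exists k => //=.
by rewrite (le_trans ks)// lee_fin.
Qed.

(** The scales [L = 2 ^ n] suffice: between two of them the square root of the
    time is multiplied by two. *)
Lemma ae_dla_R_le_sqrt :
  {ae P, forall w, exists C : R, forall t, 1 <= t ->
     (dla_R N hold dir t w <= (C * Num.sqrt t)%:E)%E}.
Proof.
have [c [c0 c1 mu_c]] : exists c, [/\ 0 <= c, c < 1 & mu < c].
  have mid (x : R) : 0 < x -> x < 1 -> exists c, [/\ 0 <= c, c < 1 & x < c].
    by move=> x0 x1; exists ((1 + x) / 2); split; lra.
  exact: mid.
pose m := Num.bound ((1 + c) / (1 - c)).
have cm : c * m.+1%:R <= m%:R - 1.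
  have : (1 + c) / (1 - c) < m%:R.
    by apply: archi_boundP; apply: divr_ge0; lra.
  rewrite ltr_pdivrMr; last by lra.
  rewrite -natr1; lra.
pose Y := (Num.bound (4 * expR 2 * (m%:R + 4) : R)).+1.
have large_Y : 4 * expR 2 * (m%:R + 4) <= 2 ^+ Y :> R.
  apply: (@le_trans _ _ Y%:R).
    apply: ltW; apply: (@lt_le_trans _ _ Y.-1%:R); last by rewrite ler_nat.
    by apply: archi_boundP; rewrite !mulr_ge0 ?expR_ge0 ?addr_ge0.
  by have := ltn_expl Y (isT : (1 < 2)%N); rewrite -(ltr_nat R) natrX => /ltW.
have a0 := median_gt0 D_gt0.
pose a := median D.
have ae1 := ae_linearly_bounded N_stationary (N_mean 0%N) N_ergodic mu_c.
have ae2 := ae_hold_gt0 D_gt0 walks.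
have ae3 := ae_slow_infinitely_often D_gt0 walks.
have ae4 := ae_no_tie D_gt0 walks.
have ae5 := ae_eventually_not_crowded D_gt0 walks N_mean (ltW mu_lt1) m (ltn0Sn _ : (0 < Y)%N).
near=> w.
have [M bounded] : linearly_bounded c (seq_of N w) by near: w.
have hold_gt0 : forall p i, 0 < hold p i w by near: w.
have often : forall p m, exists2 i, (m <= i)%N & slow D hold p i w by near: w.
have no_tie : forall p q n m, p != q ->
  jump_time (fun i => hold p i w) n.+1 != jump_time (fun i => hold q i w) m.+1 by near: w.
have [n0 calm] : exists n0, forall n, (n0 <= n)%N -> ~ crowded D N hold dir m Y (2 ^ n)%N w.
  by near: w.
pose L n := (2 ^ n)%N.
have L_gt0 n : (0 < L n)%N by rewrite expn_gt0.
pose n1 := maxn n0 (4 * M)%N.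
have front n s : (n1 <= n)%N -> s < a * (L n * L n)%:R ->
    (dla_R N hold dir s w <= (front_site m Y (L n))%:R%:E)%E.
  rewrite geq_max => /andP[n0n Mn] st.
  apply: (front_le_of_few_visitors _ _ _ st) => //.
    by move=> p t; apply: (jump_time_unbounded_of_slow D_gt0).
  move=> l ul lP.
  apply: (@few_visitors m Y c _ _ _ _ _ w M (L n) _ _ bounded _ _ l ul lP) => //.
  - exact: ltW.
  - by rewrite (leq_trans Mn)// ltnW// ltn_expl.
  - exact: calm.
pose C := (m * Y)%:R * ((2 ^ n1)%:R + 2 / Num.sqrt a).
exists C => t t1.
have sqrt_a0 : 0 < Num.sqrt a by rewrite sqrtr_gt0.
have sqrt_t1 : 1 <= Num.sqrt t by rewrite -sqrtr1 ler_wsqrtr.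
have ex_n : exists n, (n1 <= n)%N && (t < a * (L n * L n)%:R).
  pose j := Num.bound (t / a); exists (maxn n1 j); rewrite leq_maxl /=.
  rewrite mulrC -ltr_pdivrMr//.
  apply: lt_le_trans (archi_boundP _) _; first by rewrite divr_ge0 ?(ltW a0)//; lra.
  rewrite ler_nat -/j (leq_trans (ltnW (ltn_expl j (isT : (1 < 2)%N))))//.
  apply: (@leq_trans (L (maxn n1 j))); first by rewrite leq_pexp2l// leq_maxr.
  by rewrite leq_pmulr.
(* the first scale whose time exceeds [t]; the time of the previous one does not *)
case: (ex_minnP ex_n) => n /andP[n1n tn] nmin.
apply: (le_trans (front n t n1n tn)); rewrite lee_fin /front_site natrM /C -mulrA.
apply: ler_wpM2l => //; rewrite mulrDl.
have u0 : 0 <= (2 ^ n1)%:R * (Num.sqrt t - 1) by rewrite mulr_ge0// subr_ge0.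
have v0 : 0 <= 2 / Num.sqrt a * Num.sqrt t by rewrite !mulr_ge0 ?invr_ge0 ?(ltW sqrt_a0)//; lra.
move: n1n; rewrite leq_eqVlt => /predU1P[<-|]; first by rewrite /L; lra.
case: n tn nmin => // n tn nmin; rewrite ltnS => n1n.
have tn' : a * (L n * L n)%:R <= t.
  by rewrite leNgt; apply/negP => lt1; have := nmin n; rewrite n1n lt1 ltnn => /(_ isT).
have : Num.sqrt a * (L n)%:R <= Num.sqrt t.
  apply: le_trans (ler_wsqrtr tn'); rewrite [leRHS]sqrtrM; last exact: ltW.
  by rewrite natrM -expr2 sqrtr_sqr ger0_norm.
rewrite mulrC -ler_pdivlMr// => Ln.
rewrite /L expnS natrM -/(L n) mulrAC.
have w0 : 0 <= (2 ^ n1)%:R :> R by [].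
rewrite -mulrA [Num.sqrt t * _]mulrC; move: Ln; rewrite mulrC; lra.
Unshelve. all: by end_near.
Qed.

End main_bound.

(** * Measurability of the front *)
Section measurable_front.
Context {R : realType} {d : measure_display} {Omega : measurableType d}
  (P : probability Omega R)
  (N : nat -> {mfun Omega >-> nat})
  (hold : particle -> nat -> {RV P >-> R})
  (dir : particle -> nat -> {RV P >-> bool}).

Lemma measurable_fun_of_lt (f : Omega -> \bar R) :
  (forall r : R, measurable [set w | (f w < r%:E)%E]) -> measurable_fun setT f.
Proof.
move=> mf; apply: (measurability _ (ErealGenInftyO.measurableE R)).
move=> _ [_ [r ->] <-]; rewrite setTI.
rewrite (_ : f @^-1` _ = [set w | (f w < r%:E)%E]); first exact: mf.
by apply/seteqP; split => w /=; rewrite in_itv.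
Qed.

Local Notation h := (fun w p n => hold p n w).
Local Notation b := (fun w p n => dir p n w).
Local Notation tau k := (fun w => dla_tau (seq_of N w) (h w) (b w) k).
Local Notation white k p := [set w | (dla_state (seq_of N w) (h w) (b w) k).2 p].
Local Notation jumps p n := (fun w => jump_time (h w p) n).
Local Notation at_site p n y := [set w | walk_pos (start p) (b w p) n = y].

Lemma measurable_jump_time p n : measurable_fun setT (jumps p n).
Proof. by apply: measurable_sum => i; exact: measurable_hold. Qed.

Lemma measurable_jump_timeE p n : measurable_fun setT (fun w => (jump_time (h w p) n)%:E).
Proof. by apply/measurable_EFinP; exact: measurable_jump_time. Qed.

Lemma measurable_at_site p n y : measurable (at_site p n y).
Proof.
elim: n y => [|n IH] y.
  rewrite (_ : at_site p 0 y = if start p == y then setT else set0); first by case: ifP.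
  apply/seteqP; split => w /=; rewrite /walk_pos big_ord0 addr0.
    by move=> ->; rewrite eqxx.
  by case: eqP.
rewrite (_ : at_site p n.+1 y =
    ([set w | dir p n w = true] `&` at_site p n (y - 1)) `|`
    ([set w | dir p n w = false] `&` at_site p n (y + 1))).
  by apply: measurableU; apply: measurableI => //; apply: measurable_boolval.
apply/seteqP; split => w /=; rewrite walk_posS.
  by case: (dir p n w) => e; [left|right]; split => //; lia.
by move=> [[-> e]|[-> e]]; lia.
Qed.

Lemma measurable_exists_particle (A : particle -> set Omega) :
  (forall p, measurable (A p)) -> measurable [set w | exists p, A p w].
Proof.
move=> mA; rewrite (_ : [set w | _] = \bigcup_i \bigcup_j A (i, j)).
  by apply: bigcup_measurable => i _; apply: bigcup_measurable.
apply/seteqP; split => w /=; first by move=> [[i j] Aw]; exists i => //; exists j.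
by move=> [i _ [j _ Aw]]; exists (i, j).
Qed.

(** By induction: the next time is an infimum over the countably many jumps of
    all the particles, and the particles that change color are determined by
    comparisons of this time with jump times. *)
Lemma measurable_tau_white k :
  measurable_fun setT (tau k) /\ forall p, measurable (white k p).
Proof.
elim: k => [|k [mtau mwhite]].
  split; first exact: measurable_cst.
  by move=> p; exact: (measurable_alive N p).
have mltE (f g : Omega -> \bar R) : measurable_fun setT f -> measurable_fun setT g ->
    measurable [set w | (f w < g w)%E].
  by move=> mf mg; rewrite -[X in measurable X]setTI; exact: measurable_lte.
have mleE (f g : Omega -> \bar R) : measurable_fun setT f -> measurable_fun setT g ->
    measurable [set w | (f w <= g w)%E].
  by move=> mf mg; rewrite -[X in measurable X]setTI; exact: measurable_lee.
have mtauS : measurable_fun setT (tau k.+1).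
  apply: measurable_fun_of_lt => r.
  pose hit (p : particle) := \bigcup_n (white k p `&` at_site p n.+1 k%:Z `&`
     [set w | (tau k w < (jump_time (h w p) n.+1)%:E)%E] `&`
     [set w | ((jump_time (h w p) n.+1)%:E < r%:E)%E]).
  rewrite (_ : [set w | _] = [set w | exists p, hit p w]).
    apply: measurable_exists_particle => p; apply: bigcup_measurable => n _.
    apply: measurableI; last first.
      by apply: mltE; [exact: measurable_jump_timeE|exact: measurable_cst].
    apply: measurableI; last by apply: mltE => //; exact: measurable_jump_timeE.
    by apply: measurableI => //; exact: measurable_at_site.
  apply/seteqP; split => w /=.
    rewrite tauS => /ereal_inf_lt[_ [t [taut [p wp [n [tE posn]]]] <-]] tr.
    by exists p, n => //; rewrite /= -tE.
  move=> [p [n _ [[[wp posn] taut] tr]]]; rewrite tauS.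
  apply: le_lt_trans tr; apply: ereal_inf_lbound.
  exists (jump_time (h w p) n.+1) => //; split => //.
  by exists p => //; exists n.
split => // p.
pose leaves n := at_site p n k.+1%:Z `&`
   [set w | ((jump_time (h w p) n)%:E < tau k.+1 w)%E] `&`
   [set w | (tau k.+1 w <= (jump_time (h w p) n.+1)%:E)%E].
rewrite (_ : white k.+1 p = white k p `\` \bigcup_n leaves n).
  apply: measurableD => //; apply: bigcup_measurable => n _.
  apply: measurableI; last by apply: mleE => //; exact: measurable_jump_timeE.
  apply: measurableI; first exact: measurable_at_site.
  by apply: mltE => //; exact: measurable_jump_timeE.
apply/seteqP; split => w /=; rewrite whiteS.
  move=> [wp nw]; split => // -[n _ [[posn lt1] le1]]; apply: nw.
  move: lt1 le1; rewrite /= ; case e : (dla_tau _ _ _ _) => [t| |] //.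
  rewrite lte_fin lee_fin => lt1 le1; exists t => //; exists n.
  by rewrite lt1 le1.
move=> [wp nw]; split => // -[t te [n [/andP[lt1 le1] posn]]]; apply: nw.
by exists n => //; split => /=; [split => //|]; rewrite /= te ?lte_fin ?lee_fin.
Qed.

(** The front takes integer values and [tau] is nondecreasing. *)
Lemma dla_R_ge_tau (y : R) : 0 < y -> exists k, forall t w,
  (y%:E <= dla_R N hold dir t w)%E <-> (tau k w <= t%:E)%E.
Proof.
move=> y0; pose k := `|Num.ceil y|%N.
have kE : k%:R = (Num.ceil y)%:~R :> R.
  by rewrite /k natr_absz ger0_norm// ceil_ge0// (lt_trans _ y0).
have yk : y <= k%:R by rewrite kE ceil_ge.
have k_min j : (j < k)%N -> j%:R < y.
  move=> jk; rewrite ltNge; apply/negP => yj.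
  have : (Num.ceil y <= j%:Z)%R by rewrite ceil_le_int.
  by rewrite -(ler_int R) -kE ler_nat leqNgt jk.
exists k => t w; split => [yR|tk]; last first.
  apply: (@le_trans _ _ k%:R%:E); first by rewrite lee_fin.
  by apply: ereal_sup_ubound; exists k.
rewrite leNgt; apply/negP => tk; move: yR; apply/negP; rewrite -ltNge.
have k_gt0 : (0 < k)%N by rewrite -(ltr_nat R) (lt_le_trans y0).
apply: (@le_lt_trans _ _ k.-1%:R%:E); last first.
  by rewrite lte_fin k_min// prednK.
apply: ge_ereal_sup => _ [j /= jt <-]; rewrite lee_fin ler_nat -ltnS prednK//.
rewrite ltnNge; apply/negP => kj.
by have := lt_le_trans tk (tau_nd _ _ _ kj); rewrite ltNge jt.
Qed.

Lemma measurable_dla_R_ge (y t : R) : 0 < y ->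
  measurable [set w | (y%:E <= dla_R N hold dir t w)%E].
Proof.
move=> y0; have [k kP] := dla_R_ge_tau y0.
rewrite (_ : [set w | _] = [set w | (tau k w <= t%:E)%E]).
  rewrite -[X in measurable X]setTI; apply: measurable_lee => //.
  exact: (measurable_tau_white k).1.
by apply/seteqP; split => w /kP.
Qed.

Lemma dla_R_ge0 t w : 0 <= t -> (0 <= dla_R N hold dir t w)%E.
Proof. by move=> t0; apply: ereal_sup_ubound; exists 0%N => //=; rewrite /dla_tau /= lee_fin. Qed.

End measurable_front.

(** * Consequences of the square root bound *)
Section conclusions.
Context {R : realType} {d : measure_display} {Omega : measurableType d}
  (P : probability Omega R)
  (N : nat -> {mfun Omega >-> nat})
  (hold : particle -> nat -> {RV P >-> R})
  (dir : particle -> nat -> {RV P >-> bool}).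
Local Notation front := (dla_R N hold dir).

Lemma log_rate_of_sqrt_bound w (C : R) :
  (forall t, 1 <= t -> (front t w <= (C * Num.sqrt t)%:E)%E) ->
  (front t w * ((ln t ^+ 2 * Num.sqrt t)^-1)%:E)%E @[t --> +oo%R] --> 0%E.
Proof.
move=> bound.
have lny : (ln t : R) @[t --> +oo%R] --> +oo%R.
  apply/cvgryPge => A; near=> t.
  have tA : expR A <= t by near: t; exact: nbhs_pinfty_ge.
  by rewrite -(expRK A) ler_ln ?posrE ?expR_gt0//.
have ln_gt0 : \forall t \near +oo%R, (0 : R) < ln t.
  by near=> t; rewrite ln_gt0//; near: t; exact: nbhs_pinfty_gt.
have lnV : ((ln t)^-1 : R) @[t --> +oo%R] --> (0 : R).
  by rewrite gtr0_cvgV0.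
have upper : (C * ((ln t)^-1 * (ln t)^-1))%:E @[t --> +oo%R] --> (0%:E : \bar R).
  apply: cvg_EFin; first by apply: nearW.
  rewrite -[X in _ --> X](_ : C * (0 * 0) = 0); last by rewrite !mulr0.
  exact: cvgM (cvg_cst C) (cvgM lnV lnV).
apply: (squeeze_cvge _ (cvg_cst 0%E) upper); near=> t.
have t1 : 1 <= t by near: t; exact: nbhs_pinfty_ge.
have l0 : 0 < ln t by near: t.
have s0 : 0 < Num.sqrt t by rewrite sqrtr_gt0; lra.
have inv0 : 0 <= (ln t ^+ 2 * Num.sqrt t)^-1.
  by rewrite invr_ge0 mulr_ge0 ?sqr_ge0// ltW.
apply/andP; split.
  by apply: mule_ge0; rewrite ?lee_fin// dla_R_ge0//; lra.
apply: (le_trans (lee_wpmul2r _ (bound t t1))); first by rewrite lee_fin.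
rewrite -EFinM lee_fin le_eqVlt; apply/orP; left; apply/eqP.
by field; rewrite !gt_eqF.
Unshelve. all: by end_near.
Qed.

Lemma limsup_of_sqrt_bound w (C : R) :
  (forall t, 1 <= t -> (front t w <= (C * Num.sqrt t)%:E)%E) ->
  (limf_esup (fun t : R => front t w * ((Num.sqrt t)^-1)%:E) (pinfty_nbhs R) < +oo)%E.
Proof.
move=> bound; apply: (@le_lt_trans _ _ C%:E); last exact: ltry.
apply: ge_ereal_inf; exists (ereal_sup [set (front t w * ((Num.sqrt t)^-1)%:E)%E | t in [set t | 1 <= t]]).
  by exists [set t | 1 <= t] => //; exact: nbhs_pinfty_ge.
apply: ge_ereal_sup => _ [t /= t1 <-].
have s0 : 0 < Num.sqrt t by rewrite sqrtr_gt0; lra.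
apply: (le_trans (lee_wpmul2r _ (bound t t1))); first by rewrite lee_fin invr_ge0 ltW.
by rewrite -EFinM mulfK// gt_eqF.
Qed.

(** The random supremum over [t >= 1] of the ratio to [sqrt t] is finite,
    hence tight. To handle measurable events only, the supremum is restricted
    to integer times, at the price of a factor [2]: the front is nondecreasing
    and the square root at most doubles from [t] to the next integer. *)
Lemma tight_of_ae_sqrt_bound :
  {ae P, forall w, exists C : R, forall t, 1 <= t -> (front t w <= (C * Num.sqrt t)%:E)%E} ->
  forall eps : R, 0 < eps -> \forall x \near +oo%R, forall t : R, 1 <= t ->
    (P [set w | ((x * Num.sqrt t)%:E <= front t w)%E] < eps%:E)%E.
Proof.
move=> bound eps eps0.
pose B (j : nat) := \bigcup_n
  [set w | ((j.+1%:R / 2 * Num.sqrt n.+1%:R)%:E <= front n.+1%:R w)%E].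
have sqrt_gt0 n : 0 < Num.sqrt n.+1%:R :> R by rewrite sqrtr_gt0.
have mB j : measurable (B j).
  by apply: bigcup_measurable => n _; apply: measurable_dla_R_ge; rewrite mulr_gt0// divr_gt0.
have mIB : measurable (\bigcap_j B j) by exact: bigcapT_measurable.
have IB0 : P (\bigcap_j B j) = 0%E.
  apply: measure_negligible => //; apply: negligibleS bound => w IB [C wC].
  have [n _ /=] := IB (Num.bound (2 * `|C|)) I.
  move=> /le_trans/(_ (wC n.+1%:R _)); rewrite ler1n => /(_ isT).
  rewrite lee_fin ler_pM2r// leNgt => /negP; apply.
  have : 2 * `|C| < (Num.bound (2 * `|C|))%:R by apply: archi_boundP; rewrite mulr_ge0.
  by rewrite -[(Num.bound _).+1%:R]natr1; have := ler_norm C; lra.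
have cvgB : P (B j) @[j --> \oo] --> 0%E.
  rewrite -IB0; apply: nonincreasing_cvg_mu => //.
    by rewrite (le_lt_trans (probability_le1 _ _))// ltry.
  apply/nonincreasing_seqP => j; apply/subsetPset => w [n _ /= le1]; exists n => //=.
  apply: le_trans le1; rewrite lee_fin ler_pM2r// ler_pM2r ?invr_gt0// ler_nat.
  exact: leqnSn.
have [j Pj] : exists j, (P (B j) < eps%:E)%E.
  apply: contrapT => /forallNP large.
  have : (eps%:E <= 0)%E.
    rewrite -(cvg_lim _ cvgB)//; apply: lime_ge; first by apply/cvg_ex; eexists; exact: cvgB.
    by apply: nearW => j; rewrite leNgt; exact/negP/large.
  by rewrite lee_fin leNgt eps0.
near=> x; move=> t t1.
have xj : j.+1%:R <= x by near: x; exact: nbhs_pinfty_ge.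
have x0 : 0 < x by apply: lt_le_trans xj.
have st0 : 0 < Num.sqrt t by rewrite sqrtr_gt0; lra.
apply: le_lt_trans Pj; apply: le_measure; rewrite ?inE//.
  by apply: measurable_dla_R_ge; rewrite mulr_gt0.
move=> w /= xw; have /andP[nt tn] := Num.Theory.truncn_itv (le_trans ler01 t1).
exists (Num.truncn t) => //=.
apply: (@le_trans _ _ (front t w)); last first.
  by apply: dla_front_nd; exact: ltW.
apply: le_trans xw; rewrite lee_fin.
rewrite -mulrA; apply: ler_pM => //; rewrite mulrC ler_pdivrMr//.
apply: (@le_trans _ _ (Num.sqrt (4 * t))).
  by apply: ler_wsqrtr; rewrite -natr1; lra.
rewrite sqrtrM// (_ : 4 = 2 ^+ 2) ?sqrtr_sqr ?ger0_norm// 1?mulrC//; last by ring.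
Unshelve. all: by end_near.
Qed.

End conclusions.
Unset Implicit Arguments.

Theorem theorem2 (R : realType) (d : measure_display)
    (Omega : measurableType d) (P : probability Omega R) (D mu : R)
    (N : nat -> {mfun Omega >-> nat})
    (hold : particle -> nat -> {RV P >-> R})
    (dir : particle -> nat -> {RV P >-> bool})
    (D_gt0 : 0 < D)
    (walks : dla_walks D N hold dir)
    (N_stationary : stationary P N)
    (N_ergodic : ergodic P N)
    (N_mean : forall i : nat, ('E_P[fun w => (N i w)%:R] = mu%:E)%E)
    (mu_gt0 : 0 < mu) (mu_lt1 : mu < 1) :
  [/\ {ae P, forall w,
         (dla_R N hold dir t w * ((ln t ^+ 2 * Num.sqrt t)^-1)%:E)%E
           @[t --> +oo%R] --> 0%E},
      (forall eps : R, 0 < eps ->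
         \forall x \near +oo%R, forall t : R, 1 <= t ->
           (P [set w | ((x * Num.sqrt t)%:E <= dla_R N hold dir t w)%E]
              < eps%:E)%E) &
      (iid_poisson P N mu ->
         {ae P, forall w,
            (limf_esup (fun t : R =>
                 dla_R N hold dir t w * ((Num.sqrt t)^-1)%:E)
               (pinfty_nbhs R) < +oo)%E})].
Proof.
have bound := ae_dla_R_le_sqrt D_gt0 walks N_stationary N_ergodic N_mean mu_gt0 mu_lt1.
split.
- by apply: filterS bound => w [C wC]; exact: log_rate_of_sqrt_bound wC.
- exact: tight_of_ae_sqrt_bound bound.
- by move=> _; apply: filterS bound => w [C wC]; exact: limsup_of_sqrt_bound wC.
Qed.
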